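(* Let $\Gamma$ be a cyclic group of order $n$, and let $r(n)=\prod_{p\mid n}p$ be the radical of $n$. (i) If $4\nmid n$, then $e_{\mathrm{nil}}(\Gamma)=e_{\mathrm{ab}}(\Gamma)=e(\Gamma,\Gamma)=n/r(n)$. (ii) If $n\equiv 4\pmod 8$, then $e_{\mathrm{nil}}(\Gamma)=e_{\mathrm{ab}}(\Gamma)=n/r(n)$, and $e(\Gamma,\Gamma)=e(\Gamma,C_2\times C_{n/2})=n/(2r(n))$. (iii) If $8\mid n$, write $n=2^v n'$ with $v\ge 3$ and $n'$ odd. Then $e_{\mathrm{nil}}(\Gamma)=3n/(2r(n))$ and $e_{\mathrm{ab}}(\Gamma)=e(\Gamma,\Gamma)=n/(2r(n))$, and moreover $e(\Gamma,D_{2^v}\times C_{n'})=e(\Gamma,Q_{2^v}\times C_{n'})=n/(2r(n))$.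
   Context: $C_m$ is the cyclic group of order $m$; for $v\ge 3$, $D_{2^v}$ and $Q_{2^v}$ are the dihedral and generalized quaternion groups of order $2^v$. For finite groups $\Gamma,G$ of the same order, $e(\Gamma,G)$ is the number of Hopf-Galois structures of type $G$ on a Galois field extension with Galois group $\Gamma$; equivalently, the number of $\mathrm{Aut}(G)$-conjugacy classes of injective homomorphisms $\beta:\Gamma\to\mathrm{Hol}(G)$ whose image acts regularly on $G$, where $\mathrm{Hol}(G)=\rho(G)\cdot\mathrm{Aut}(G)\subseteq\mathrm{Perm}(G)$ and $\rho(g)(x)=xg^{-1}$. Also $e_{\mathrm{ab}}(\Gamma)=\sum_{G \text{ abelian}} e(\Gamma,G)$ and $e_{\mathrm{nil}}(\Gamma)=\sum_{G\text{ nilpotent}} e(\Gamma,G)$, sums over isomorphism classes of abelian (resp. nilpotent) groups $G$ of order $|\Gamma|$. *)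

(* Defs.v *)
From HB Require Import structures.
From mathcomp Require Import all_boot all_algebra all_fingroup all_solvable.
Set Implicit Arguments.
Unset Strict Implicit.
Unset Printing Implicit Defensive.

Local Open Scope group_scope.

(* Hopf-Galois counting e(Gamma, G), with Gamma the full group of the finGroupType
   gT and G the full group of the finGroupType hT (arbitrary groups are handled via
   the finGroupType [subg G]). *)
Section HopfGalois.

Variables (gT hT : finGroupType).

Definition rho (g : hT) : {perm hT} := perm (mulIg g^-1).

Definition Hol : {set {perm hT}} :=
  [set rho g * a | g in [set: hT], a in Aut [set: hT]].

Definition regular_on (N : {set {perm hT}}) : bool :=
  [forall x : hT, forall y : hT, #|[set s in N | s x == y]| == 1%N].

Definition regular_embedding (beta : {ffun gT -> {perm hT}}) : bool :=
  [&& [forall x, forall y, beta (x * y) == beta x * beta y],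
      injectiveb beta,
      [forall x, beta x \in Hol] &
      regular_on (beta @: [set: gT])].

Definition regular_embeddings : {set {ffun gT -> {perm hT}}} :=
  [set beta | regular_embedding beta].

Definition aut_class (beta : {ffun gT -> {perm hT}}) : {set {ffun gT -> {perm hT}}} :=
  [set [ffun x => beta x ^ a] | a in Aut [set: hT]].

Definition e_HG : nat := #|[set aut_class beta | beta in regular_embeddings]|.

End HopfGalois.

(* Representatives of all groups of order n: subgroups of order n of Sym({0..n-1})
   (Cayley); isomorphism classes among those satisfying P. *)
Arguments e_HG : clear implicits.
Definition groups_of_order (n : nat) (P : {group {perm 'I_n}} -> bool)
  : {set {group {perm 'I_n}}} :=
  [set H in [set: {group {perm 'I_n}}] | (#|H| == n) && P H].

Definition iso_classes (n : nat) (P : {group {perm 'I_n}} -> bool)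
  : {set {set {group {perm 'I_n}}}} :=
  equivalence_partition (fun H K : {group {perm 'I_n}} => H \isog K)
                        (@groups_of_order n P).

Definition e_sum (gT : finGroupType) (P : forall n, {group {perm 'I_n}} -> bool) : nat :=
  \sum_(C in @iso_classes #|gT| (P #|gT|))
     e_HG gT (subg_of (odflt 1%G [pick H in C])).

Definition e_ab (gT : finGroupType) : nat :=
  e_sum gT (fun n (H : {group {perm 'I_n}}) => abelian H).

Definition e_nil (gT : finGroupType) : nat :=
  e_sum gT (fun n (H : {group {perm 'I_n}}) => nilpotent H).

Definition radical (n : nat) : nat := \prod_(p <- primes n) p.

(* Main.v *)
(** The affine maps [x |-> a x * g] of [G], with [g \in G] and [a \in Aut G],
    are the elements of [Hol G]. Regular embeddings of a cyclic group of order
    [n] correspond to the affine maps that are [n]-cycles, and [Aut G] acts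
    freely on them, so [e(C_n, G)] is the number of affine [n]-cycles divided by
    [#|Aut G|]; this number is multiplicative over coprime direct products.

    For cyclic [G] the affine [n]-cycles are given by the Hull-Dobell criterion.
    For a [p]-group [G] with an affine [n]-cycle [s], the [p]-group
    [H = G ><| <[a]>] factors as [<[a]> <[s]>]. If [p] is odd and [G] is not
    cyclic, an [H]-invariant elementary quotient of order [p^2] contradicts this
    factorization; if [p = 2], an elementary quotient of order 4 of an
    [H]-invariant maximal subgroup does. So for [p = 2] every invariant maximal
    subgroup is cyclic; applied to [Phi(G) Ohm_1(G)], this leaves only cyclic,
    dihedral (including [C_2 x C_2]) and quaternion groups. In the last two, each
    [Aut G]-orbit of cycles has a unique member with prescribed [g] and [a g]. *)

Require Import Defs.
From HB Require Import structures.
From mathcomp Require Import all_boot all_algebra all_fingroup all_solvable.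
From mathcomp Require Import ring.
Set Implicit Arguments.
Unset Strict Implicit.
Unset Printing Implicit Defensive.

(** * Affine cycles and regular embeddings *)

Local Open Scope group_scope.

(** A factorization is restrictive because [H] permutes the [#|T|] cosets of [A] and [<[s]>] is
    transitive on them, so [s ^+ k] cannot lie in [A] for [0 < k < #|T|]. On an elementary [T] of
    order p^2 the commutators with [H] are central, so s^p differs from an element of [A] only by a
    commutator raised to C(p, 2), which is trivial for odd p. For p = 2 this coefficient is 1, and
    the Klein four-group does have affine 4-cycles. The obstruction is therefore sought one step
    higher, in [T] of order 8 over an elementary subgroup of order 4, where s^4 falls into [A].

    Invariant subgroups come from [H] rather than from [G]: a p-group has normal subgroups of every
    possible order inside a given normal one, which provides both the elementary quotients and the
    first invariant maximal subgroup.

    The prime 2 is also exceptional in the Hull-Dobell criterion, as a multiplier -1 modulo 4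
    reaches only two residues; this costs the factor 2 in n/(2r(n)). In dihedral and quaternion
    groups two steps act on the cyclic subgroup with a square multiplier, which is automatically 1
    modulo 4. *)

Definition affine (hT : finGroupType) (u : hT * {perm hT}) (x : hT) : hT :=
  u.2 x * u.1.

(** Covering [G] by the orbit of [1] alone makes the injective map [affine u] a single cycle on [G].
    Keeping [G] inside an ambient type lets direct factors be treated without changing type. *)
Definition affine_cycles (hT : finGroupType) (G : {set hT}) :
    {set hT * {perm hT}} :=
  [set u in setX G (Aut G) | [forall x in G, fconnect (affine u) 1 x]].

Section AffineCycles.

Variables (hT : finGroupType) (G : {group hT}).
Implicit Types (u : hT * {perm hT}) (a : {perm hT}) (x g : hT).

Lemma AutM a : a \in Aut G -> {in G &, {morph a : x y / x * y}}.
Proof. by move/Aut_morphic/morphicP. Qed.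

Lemma AutX a k x : a \in Aut G -> x \in G -> a (x ^+ k) = a x ^+ k.
Proof. by move=> Aa Gx; rewrite -(autmE Aa) morphX. Qed.

Lemma Aut_id1 a : a \in Aut G -> a 1 = 1.
Proof. by move=> Aa; rewrite -(autmE Aa) morph1. Qed.

Lemma affine_inj u : injective (affine u).
Proof. by move=> x y /mulIg/perm_inj. Qed.

Lemma affine_cyclesP u :
  reflect [/\ u.1 \in G, u.2 \in Aut G
            & {in G, forall x, exists k, x = iter k (affine u) 1}]
          (u \in affine_cycles G).
Proof.
rewrite !inE; apply: (iffP andP) => [[/andP[Gg Aa] /forall_inP tr]|[Gg Aa tr]].
  split=> // x /tr c1x; exists (findex (affine u) 1 x).
  by rewrite iter_findex.
rewrite Gg Aa; split=> //; apply/forall_inP=> x /tr[k ->].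
exact: fconnect_iter.
Qed.

Lemma affine_iter_in u k :
  u.1 \in G -> u.2 \in Aut G -> iter k (affine u) 1 \in G.
Proof.
by move=> Gg Aa; elim: k => //= k IHk; rewrite groupM ?Aut_closed.
Qed.

Lemma iter_affine u k x : u.2 \in Aut G -> u.1 \in G -> x \in G ->
  iter k (affine u) x = (u.2 ^+ k) x * iter k (affine u) 1.
Proof.
move=> Aa Gg Gx; elim: k => [|k IHk]; first by rewrite expg0 perm1 mulg1.
rewrite iterS IHk /affine (AutM Aa) ?affine_iter_in ?Aut_closed ?groupX //.
by rewrite mulgA expgSr permM.
Qed.

Lemma affine_order u : u \in affine_cycles G -> fingraph.order (affine u) 1 = #|G|.
Proof.
case/affine_cyclesP=> Gg Aa tr; apply: eq_card => x; rewrite !inE.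
apply/idP/idP => [c1x|/tr[k ->]]; last exact: fconnect_iter.
by rewrite -(iter_findex c1x) affine_iter_in.
Qed.

Lemma iter_affine_eq1 u k : u \in affine_cycles G ->
  (iter k (affine u) 1 == 1) = (#|G| %| k).
Proof.
move=> Xu; have o1 := affine_order Xu.
have inj := @affine_inj u.
rewrite -o1; set f := affine u in inj o1 *.
have per j : iter (j * fingraph.order f 1) f 1 = 1.
  by elim: j => // j IHj; rewrite mulSn iterD IHj (iter_order inj).
rewrite {1}(divn_eq k (fingraph.order f 1)) addnC iterD per.
have lt_r : k %% fingraph.order f 1 < fingraph.order f 1.
  by rewrite ltn_mod fingraph.order_gt0.
rewrite /dvdn; apply/eqP/eqP => [r1|->//].
by have := findex_iter lt_r; rewrite r1 findex0.
Qed.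

(** The [#|G|]-th iterate fixes every orbit point, hence is the identity on [G], and its linear part
    is [u.2 ^+ #|G|]. This is what makes [G ><| <[u.2]>] a p-group along with [G]. *)
Lemma affine_cycle_aut_expg u : u \in affine_cycles G -> u.2 ^+ #|G| = 1.
Proof.
move=> Xu; have [Gg Aa tr] := affine_cyclesP _ Xu.
apply: (eq_Aut (groupX _ Aa) (group1 _)) => x Gx; rewrite perm1.
have n1 : iter #|G| (affine u) 1 = 1 by apply/eqP; rewrite iter_affine_eq1.
have := iter_affine #|G| Aa Gg Gx; rewrite n1 mulg1 => <-.
have [k ->] := tr x Gx.
by rewrite -iterD addnC iterD n1.
Qed.

Lemma perm_conj a b x : (b ^ a) (a x) = a (b x).
Proof. by rewrite conjgE !permM permK. Qed.

Lemma iter_affine_conj t u k : t \in Aut G -> u.1 \in G -> u.2 \in Aut G ->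
  iter k (affine (t u.1, u.2 ^ t)) 1 = t (iter k (affine u) 1).
Proof.
move=> At Gg Aa; elim: k => [|k IHk] /=; first by rewrite (Aut_id1 At).
rewrite IHk /affine /= perm_conj (AutM At) //.
by rewrite Aut_closed ?affine_iter_in.
Qed.

Lemma affine_cycles_conj t u : t \in Aut G -> u \in affine_cycles G ->
  (t u.1, u.2 ^ t) \in affine_cycles G.
Proof.
move=> At /affine_cyclesP[Gg Aa tr]; apply/affine_cyclesP; split=> /=.
- exact: Aut_closed.
- by rewrite groupJ.
move=> x Gx; have Ati := groupVr At.
have [k ek] := tr _ (Aut_closed Ati Gx); exists k.
by rewrite iter_affine_conj // -ek permKV.
Qed.

End AffineCycles.

Section RegularEmbeddings.

Variables (gT hT : finGroupType).
Hypothesis cycG : cyclic [set: gT].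
Hypothesis oGH : #|gT| = #|hT|.
Implicit Types (u : hT * {perm hT}) (b : {ffun gT -> {perm hT}}).

Definition affine_perm u : {perm hT} := perm (@affine_inj hT u).

Lemma affine_permX u k x : (affine_perm u ^+ k) x = iter k (affine u) x.
Proof.
by elim: k x => [|k IHk] x; rewrite ?expg0 ?perm1 // expgSr permM permE IHk.
Qed.

Lemma affine_perm_inj :
  {in affine_cycles [set: hT] &, injective affine_perm}.
Proof.
move=> [g a] [h b] /affine_cyclesP[/= _ Aa _] /affine_cyclesP[/= _ Ab _] eqf.
have ea x : a x * g = b x * h.
  by have := congr1 (fun s : {perm hT} => s x) eqf; rewrite !permE.
have egh : g = h.
  by have := ea 1; rewrite (Aut_id1 Aa) (Aut_id1 Ab) !mul1g.
congr (_, _) => //; apply/permP=> x.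
by have := ea x; rewrite egh => /mulIg.
Qed.

Lemma mem_HolP (s : {perm hT}) :
  reflect (exists2 u, u.2 \in Aut [set: hT] & s = affine_perm u)
          (s \in Hol hT).
Proof.
apply: (iffP imset2P) => [[g a _ Aa ->]|[[g a] /= Aa ->]].
  (* Permutations compose from left to right: [rho g * a] translates first, so its constant term is
     [a g^-1]. *)
  exists (a g^-1, a) => //; apply/permP=> x.
  by rewrite permM !permE /affine /= (AutM Aa) ?inE.
exists (a^-1 g)^-1 a; rewrite ?in_setT //; apply/permP=> x.
by rewrite permM [rho _ _]permE permE /affine invgK /= (AutM Aa) ?in_setT // permKV.
Qed.

Lemma regular_embeddingM b x y : b \in regular_embeddings gT hT ->
  b (x * y) = b x * b y.
Proof. by rewrite inE => /and4P[/forallP/(_ x)/forallP/(_ y)/eqP]. Qed.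

Lemma regular_embeddingX b x k : b \in regular_embeddings gT hT ->
  b (x ^+ k) = b x ^+ k.
Proof.
move=> Rb; elim: k => [|k IHk]; last by rewrite !expgS regular_embeddingM ?IHk.
by apply: (mulgI (b 1)); rewrite !expg0 -regular_embeddingM ?mulg1.
Qed.

(** Evaluation at a generator [c] is the bijection. Transitivity of the image says that the orbit of
    [1] under [b c] is everything; conversely an affine cycle has order [#|hT|] as a permutation, so
    sending [c ^+ k] to its [k]-th power is well defined and injective. *)
Lemma card_regular_embeddings :
  #|regular_embeddings gT hT| = #|affine_cycles [set: hT]|.
Proof.
have [c defG] := cyclicP cycG.
have Gc x : exists k, x = c ^+ k by apply/cycleP; rewrite -defG inE.
have oc : #[c] = #|hT| by rewrite orderE -defG cardsT.
rewrite -(card_in_imset affine_perm_inj).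
rewrite -(@card_in_imset _ _ (fun b : {ffun gT -> {perm hT}} => b c)); last first.
  move=> b1 b2 R1 R2 ebc; apply/ffunP=> x; have [k ->] := Gc x.
  by rewrite !regular_embeddingX // ebc.
congr #|pred_of_set _|; apply/setP=> s; apply/imsetP/imsetP=> [[b Rb ->]|[u Xu ->]].
  have := Rb; rewrite inE => /and4P[_ _ /forallP/(_ c)/mem_HolP[u Au ebc] reg].
  exists u => //; apply/affine_cyclesP; rewrite in_setT; split=> // x _.
  move/forallP/(_ 1)/forallP/(_ x)/cards1P: reg => [t /setP/(_ t)].
  rewrite !inE eqxx => /andP[/imsetP[y _ ->] /eqP <-].
  have [k ->] := Gc y; exists k.
  by rewrite regular_embeddingX // ebc affine_permX.
set s0 := affine_perm u; have [Gg Aa tr] := affine_cyclesP _ _ Xu.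
have s0_eq1 k : (s0 ^+ k == 1) = (#|hT| %| k).
  rewrite -[#|hT|]cardsT -(iter_affine_eq1 _ Xu) -affine_permX -/s0.
  apply/eqP/eqP=> [->|s1]; first by rewrite perm1.
  apply/permP=> x; have [j ->] := tr x (in_setT _).
  by rewrite -affine_permX -/s0 -permM -expgD addnC expgD permM s1 perm1.
have os0 : #[s0] = #|hT|.
  by apply/eqP; rewrite eqn_dvd order_dvdn s0_eq1 dvdnn -s0_eq1 expg_order eqxx.
have dvd0 : #[s0] %| #[c] by rewrite os0 oc.
pose b := [ffun x => eltm dvd0 x].
have bX k : b (c ^+ k) = s0 ^+ k by rewrite ffunE eltmE.
exists b; last by rewrite -[c]expg1 bX expg1.
rewrite inE; apply/and4P; split.
- apply/forallP=> x; apply/forallP=> y; have [i ->] := Gc x; have [j ->] := Gc y.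
  by rewrite -expgD !bX expgD.
- apply/injectiveP=> x y; have [i ->] := Gc x; have [j ->] := Gc y.
  by rewrite !bX => /eqP; rewrite eq_expg_mod_order os0 -oc -eq_expg_mod_order=> /eqP.
- apply/forallP=> x; have [i ->] := Gc x; rewrite bX -/s0.
  apply/mem_HolP; exists (iter i (affine u) 1, u.2 ^+ i); first by rewrite groupX.
  apply/permP=> y; rewrite affine_permX permE /affine /=.
  by apply: (@iter_affine _ [set: hT]%G) => //; rewrite in_setT.
apply/forallP=> x; apply/forallP=> y; apply/cards1P.
have [i ei] := tr x (in_setT _); have [j ej] := tr y (in_setT _).
have s0V : s0 ^- i = s0 ^+ (i * #|hT|.-1).
  apply/eqP; rewrite eq_invg_mul -expgD s0_eq1 -mulnS prednK ?dvdn_mull //.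
  by apply/card_gt0P; exists 1.
exists (s0 ^+ j * s0 ^- i); apply/setP=> t; rewrite !inE.
have sx : (s0 ^+ j * s0 ^- i) x = y.
  by rewrite s0V -expgD addnC expgD -s0V permM ei -affine_permX -/s0 permK affine_permX.
apply/andP/eqP=> [[/imsetP[z _ ->]]|->]; last first.
  split; last by rewrite sx.
  by apply/imsetP; exists (c ^+ (j + i * #|hT|.-1)); rewrite ?inE // bX expgD s0V.
(* Two powers of [s0] that agree at [x] agree on the whole orbit of [x], since they commute with
   [s0]. *)
have [k ->] := Gc z; rewrite bX => /eqP tx.
apply/permP=> w; have [l ->] := tr w (in_setT _).
have cx : iter l (affine u) 1 = (s0 ^- i * s0 ^+ l) x.
  by rewrite permM ei -!affine_permX -/s0 permK.
rewrite cx -!permM s0V -!expgD.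
have cD m : s0 ^+ (i * #|hT|.-1 + l + m) = s0 ^+ m * s0 ^+ (i * #|hT|.-1 + l).
  by rewrite -expgD addnC.
by rewrite !cD !permM tx (expgD _ j) -s0V sx.
Qed.

Lemma conj_ffun_is_action : is_action [set: {perm hT}]
  (fun b a => [ffun x => b x ^ a] : {ffun gT -> {perm hT}}).
Proof.
apply: is_total_action => [b|b a1 a2]; apply/ffunP=> x; rewrite !ffunE ?conjg1 //.
by rewrite conjgM.
Qed.

Definition conj_ffun_action := Action conj_ffun_is_action.

Lemma affine_perm_conj a u : a \in Aut [set: hT] -> u.2 \in Aut [set: hT] ->
  affine_perm u ^ a = affine_perm (a u.1, u.2 ^ a).
Proof.
move=> Aa Au; apply/permP=> x; rewrite -[x](permKV a) perm_conj !permE /affine /=.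
by rewrite (AutM Aa) ?inE // perm_conj.
Qed.

(* [Aut [set: hT]] acts freely on regular embeddings: an automorphism fixes 1,
   so if it centralises a transitive group it is trivial. *)
Lemma e_HG_mul_Aut :
  (e_HG gT hT * #|Aut [set: hT]|)%N = #|affine_cycles [set: hT]|.
Proof.
rewrite -card_regular_embeddings.
have actR : [acts Aut [set: hT], on regular_embeddings gT hT | conj_ffun_action].
  apply/subsetP=> a Aa; rewrite !inE /=; apply/subsetP=> b.
  rewrite !inE => /and4P[/forallP bM /injectiveP bI /forallP bH /forallP breg].
  apply/and4P; split.
  - apply/forallP=> x; apply/forallP=> y; rewrite !ffunE -conjMg.
    by move/forallP/(_ y)/eqP: (bM x) => ->.
  - by apply/injectiveP=> x y; rewrite !ffunE => /conjg_inj/bI.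
  - apply/forallP=> x; rewrite ffunE; have /mem_HolP[u Au ->] := bH x.
    apply/mem_HolP; exists (a u.1, u.2 ^ a); first by rewrite groupJ.
    exact: affine_perm_conj.
  apply/forallP=> x; apply/forallP=> y.
  have /forallP/(_ (a^-1 y))/cards1P[t /setP Et] := breg (a^-1 x).
  apply/cards1P; exists (t ^ a); apply/setP=> s; rewrite !inE.
  have := Et (s ^ a^-1); rewrite !inE (canF_eq (conjgKV a)) => <-.
  congr (_ && _).
    apply/imsetP/imsetP=> [[z _ ->]|[z _ ez]]; exists z; rewrite ?inE ?ffunE //.
      by rewrite conjgK.
    by rewrite -ez conjgKV.
  by rewrite perm_conj (inj_eq perm_inj).
have cardO C :
    C \in orbit conj_ffun_action (Aut [set: hT]) @: regular_embeddings gT hT ->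
  #|C| = #|Aut [set: hT]|.
  case/imsetP=> b Rb ->; rewrite card_orbit.
  suff -> : 'C_(Aut [set: hT])[b | conj_ffun_action] = 1 by rewrite indexg1.
  apply/trivgP/subsetP=> a /setIP[Aa /astab1P eab]; rewrite inE.
  apply/eqP/permP=> x; rewrite perm1.
  have := Rb; rewrite inE => /and4P[_ _ _ /forallP/(_ 1)/forallP/(_ x)].
  case/cards1P=> t /setP/(_ t).
  rewrite !inE eqxx => /andP[/imsetP[y _ ->] /eqP <-].
  have := perm_conj a (b y) 1; rewrite (Aut_id1 Aa).
  by have /ffunP/(_ y) := eab; rewrite ffunE => ->.
rewrite -(acts_sum_card_orbit actR) (eq_bigr _ cardO) sum_nat_const.
by congr (_ * _)%N.
Qed.

End RegularEmbeddings.

(** * Isomorphic and coprime direct factors *)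

Lemma leq_card_affine_cycles_isog (hT kT : finGroupType) (G : {group hT})
    (K : {group kT}) :
  G \isog K -> #|affine_cycles G| <= #|affine_cycles K|.
Proof.
case/isogP=> f injf <-; pose F u := (f u.1, Aut_isom injf (subxx G) u.2).
have injF : {in affine_cycles G &, injective F}.
  move=> [g a] [h b] /affine_cyclesP[/= Gg Aa _] /affine_cyclesP[/= Gh Ab _] [eg ea].
  congr (_, _); first exact: (injmP injf).
  by apply: (injmP (injm_Aut_isom injf (subxx G))).
rewrite -(card_in_imset injF); apply/subset_leq_card/subsetP=> _ /imsetP[[g a] Xu ->].
have /affine_cyclesP[/= Gg Aa tr] := Xu.
apply/affine_cyclesP; split=> /=; rewrite ?mem_morphim ?Aut_Aut_isom //.
move=> _ /morphimP[x _ Gx ->]; have [k ->] := tr x Gx; exists k.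
elim: k => [|k IHk] /=; first by rewrite morph1.
have Gk := @affine_iter_in _ G (g, a) k Gg Aa.
by rewrite -IHk /affine /= morphM ?Aut_closed // Aut_isomE.
Qed.

Lemma card_affine_cycles_isog (hT kT : finGroupType) (G : {group hT})
    (K : {group kT}) :
  G \isog K -> #|affine_cycles G| = #|affine_cycles K|.
Proof.
move=> isoGK; apply/eqP; rewrite eqn_leq.
by rewrite !leq_card_affine_cycles_isog // isog_sym.
Qed.

Lemma card_Aut_isog (hT kT : finGroupType) (G : {group hT}) (K : {group kT}) :
  G \isog K -> #|Aut G| = #|Aut K|.
Proof.
by case/isogP=> f injf <-; rewrite (card_isog (injm_Aut injf (subxx G))).
Qed.

Lemma expg_card_coprime (hT : finGroupType) (A B : {group hT}) x :
  coprime #|A| #|B| -> x \in A -> x ^+ #|B| = 1 -> x = 1.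
Proof.
move=> coAB Ax xB; apply/eqP; rewrite -order_eq1 -dvdn1 -(eqP coAB).
by rewrite dvdn_gcd order_dvdG //= order_dvdn xB.
Qed.

Section CoprimeProduct.

Variables (hT : finGroupType) (G H K : {group hT}).
Hypotheses (defG : H \x K = G) (coHK : coprime #|H| #|K|).
Implicit Types (a : {perm hT}) (x y : hT) (u : hT * {perm hT}).

Let sHG : H \subset G. Proof. by case/dprodP: defG => _ <- _ _; apply: mulG_subl. Qed.
Let cHK : K \subset 'C(H). Proof. by case/dprodP: defG. Qed.
Let GE : H * K = G. Proof. by case/dprodP: defG. Qed.

(** Raising [a x = y * z] to the power [#|H|] leaves [z ^+ #|H| = 1], which forces [z = 1] in
    [K]. *)
Lemma Aut_coprime_dprodl a x : a \in Aut G -> x \in H -> a x \in H.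
Proof.
move=> Aa Hx; have Gx := subsetP sHG x Hx.
have := Aut_closed Aa Gx; rewrite -GE => /mulsgP[y z Hy Kz eax].
have cyz : commute y z by apply/esym; apply: (centP (subsetP cHK z Kz)).
have z1 : z = 1.
  apply: (expg_card_coprime (A := K) (B := H)) => //; first by rewrite coprime_sym.
  have : a x ^+ #|H| = 1 by rewrite -(AutX _ Aa Gx) expg_cardG ?(Aut_id1 Aa).
  by rewrite eax expgMn // (expg_cardG Hy) mul1g.
by rewrite eax z1 mulg1.
Qed.

End CoprimeProduct.

Section CoprimeProductCount.

Variables (hT : finGroupType) (G H K : {group hT}).
Hypotheses (defG : H \x K = G) (coHK : coprime #|H| #|K|).
Implicit Types (a : {perm hT}) (x y : hT) (u : hT * {perm hT}).

Let sHG : H \subset G. Proof. by case/dprodP: defG => _ <- _ _; apply: mulG_subl. Qed.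
Let sKG : K \subset G. Proof. by case/dprodP: defG => _ <- _ _; apply: mulG_subr. Qed.
Let tiHK : H :&: K = 1. Proof. by case/dprodP: defG. Qed.
Let cHK : K \subset 'C(H). Proof. by case/dprodP: defG. Qed.
Let GE : H * K = G. Proof. by case/dprodP: defG. Qed.

Lemma Aut_coprime_dprodr a x : a \in Aut G -> x \in K -> a x \in K.
Proof.
by apply: (@Aut_coprime_dprodl _ G K H); rewrite 1?dprodC // coprime_sym.
Qed.

Lemma restr_perm_Aut_l a x : a \in Aut G -> x \in H -> restr_perm H a x = a x.
Proof.
move=> Aa Hx; apply: restr_permE => //; rewrite !inE /=; apply/subsetP=> y Hy.
by rewrite inE /= /aperm (Aut_coprime_dprodl defG).
Qed.

Lemma restr_perm_Aut_r a x : a \in Aut G -> x \in K -> restr_perm K a x = a x.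
Proof.
move=> Aa Kx; apply: restr_permE => //; rewrite !inE /=; apply/subsetP=> y Ky.
by rewrite inE /= /aperm Aut_coprime_dprodr.
Qed.

Lemma Aut_dprod_exists a b : a \in Aut H -> b \in Aut K ->
  exists2 c, c \in Aut G & restr_perm H c = a /\ restr_perm K c = b.
Proof.
move=> Aa Ab.
have cab : autm Ab @* K \subset 'C(autm Aa @* H) by rewrite !im_autm.
have injc : 'injm (dprodm defG cab).
  by rewrite injm_dprodm !injm_autm !im_autm tiHK /=.
have imc : dprodm defG cab @* G = G by rewrite im_dprodm !im_autm.
pose c := aut injc imc; have Ac : c \in Aut G by apply: Aut_aut.
exists c => //; split.
  apply: (eq_Aut (Aut_restr_perm sHG Ac) Aa) => x Hx.
  by rewrite restr_perm_Aut_l // autE ?(subsetP sHG) //; apply: (dprodmEl defG cab).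
apply: (eq_Aut (Aut_restr_perm sKG Ac) Ab) => x Kx.
by rewrite restr_perm_Aut_r // autE ?(subsetP sKG) //; apply: (dprodmEr defG cab).
Qed.

Lemma Aut_dprod_inj a b : a \in Aut G -> b \in Aut G ->
  restr_perm H a = restr_perm H b -> restr_perm K a = restr_perm K b -> a = b.
Proof.
move=> Aa Ab eH eK; apply: (eq_Aut Aa Ab) => x.
rewrite -GE => /mulsgP[y z Hy Kz ->].
rewrite (AutM Aa) ?(AutM Ab) ?(subsetP sHG y) ?(subsetP sKG z) //.
rewrite -(restr_perm_Aut_l Aa Hy) -(restr_perm_Aut_l Ab Hy).
by rewrite -(restr_perm_Aut_r Aa Kz) -(restr_perm_Aut_r Ab Kz) eH eK.
Qed.

Lemma card_Aut_coprime_dprod : #|Aut G| = (#|Aut H| * #|Aut K|)%N.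
Proof.
rewrite -cardsX -(@card_in_imset _ _ (fun a => (restr_perm H a, restr_perm K a))).
  congr #|pred_of_set _|; apply/setP=> -[a b]; rewrite in_setX /=.
  apply/imsetP/andP=> [[c Ac [-> ->]]|[Aa Ab]].
    by rewrite (Aut_restr_perm sHG Ac) (Aut_restr_perm sKG Ac).
  by have [c Ac [<- <-]] := Aut_dprod_exists Aa Ab; exists c.
by move=> a b Aa Ab [eH eK]; apply: Aut_dprod_inj.
Qed.

Let f1 := divgr H K.
Let f2 := remgr H K.
Let F u := ((f1 u.1, restr_perm H u.2), (f2 u.1, restr_perm K u.2)).

Let f12 y z : y \in H -> z \in K -> f1 (y * z) = y /\ f2 (y * z) = z.
Proof. by move=> Hy Kz; rewrite /f1 /f2 divgrMid ?remgrMid. Qed.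

Let iterF u k : u.1 \in G -> u.2 \in Aut G ->
  iter k (affine u) 1 = iter k (affine (F u).1) 1 * iter k (affine (F u).2) 1
  /\ (iter k (affine (F u).1) 1 \in H /\ iter k (affine (F u).2) 1 \in K).
Proof.
case: u => g a /= Gg Aa; rewrite -GE in Gg.
have Hg : f1 g \in H by apply: mem_divgr.
have Kg : f2 g \in K by apply: mem_remgr.
elim: k => [|k [IHk [Hk Kk]]] /=; first by rewrite mulg1.
set x := iter k _ 1 in Hk IHk *; set y := iter k _ 1 in Kk IHk *.
rewrite IHk /affine /= (AutM Aa) ?(subsetP sHG x) ?(subsetP sKG y) //.
rewrite restr_perm_Aut_l // restr_perm_Aut_r //.
have Hax : a x \in H by apply: (Aut_coprime_dprodl defG).
have Kay : a y \in K by apply: Aut_coprime_dprodr.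
split; last by split; apply: groupM.
rewrite [in LHS](divgr_eq H K g) -/f1 -/f2.
move: (centP (subsetP cHK _ Kay) _ Hg); move: (f1 g) (f2 g) => y1 y2 cy.
by rewrite -!mulgA; congr (_ * _); rewrite mulgA cy mulgA.
Qed.

(** The components [F u] have the projections of the orbit of [u] as their orbits. Conversely, the
    times [k1] and [k2] at which two given cycles reach [y] and [z] are merged by the Chinese
    remainder theorem, the two periods being coprime. *)
Lemma card_affine_cycles_coprime_dprod :
  #|affine_cycles G| = (#|affine_cycles H| * #|affine_cycles K|)%N.
Proof.
rewrite -cardsX -(@card_in_imset _ _ F); last first.
  move=> [g a] [h b] /affine_cyclesP[/= _ Aa _] /affine_cyclesP[/= _ Ab _].
  case=> e1 eH e2 eK; rewrite (Aut_dprod_inj Aa Ab eH eK).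
  by rewrite (divgr_eq H K g) (divgr_eq H K h) -/f1 -/f2 e1 e2.
congr #|pred_of_set _|; apply/setP=> -[[g1 a1] [g2 a2]]; rewrite in_setX /=.
apply/imsetP/andP=> [[[g a] Xu [-> -> -> ->]]|[X1 X2]].
  have /affine_cyclesP[/= Gg Aa tr] := Xu.
  have GgE := Gg; rewrite -GE in GgE; split; apply/affine_cyclesP; split=> /=.
  - exact: mem_divgr.
  - exact: Aut_restr_perm Aa.
  - move=> x Hx; have [k ek] := tr x (subsetP sHG x Hx); exists k.
    have [e [Hk Kk]] := @iterF (g, a) k Gg Aa.
    have [<- _] := f12 Hk Kk.
    by have [] := f12 Hx (group1 K); rewrite -e -ek mulg1.
  - exact: mem_remgr.
  - exact: Aut_restr_perm Aa.
  - move=> x Kx; have [k ek] := tr x (subsetP sKG x Kx); exists k.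
    have [e [Hk Kk]] := @iterF (g, a) k Gg Aa.
    have [_ <-] := f12 Hk Kk.
    by have [] := f12 (group1 H) Kx; rewrite -e -ek mul1g.
have /affine_cyclesP[/= Hg1 Aa1 tr1] := X1.
have /affine_cyclesP[/= Kg2 Aa2 tr2] := X2.
have [a Aa [ea1 ea2]] := Aut_dprod_exists Aa1 Aa2.
have FE : F (g1 * g2, a) = ((g1, a1), (g2, a2)).
  by rewrite /F /= ea1 ea2; have [-> ->] := f12 Hg1 Kg2.
have Gg : g1 * g2 \in G by rewrite -GE mem_mulg.
exists (g1 * g2, a) => //; apply/affine_cyclesP; split=> // x.
rewrite -GE => /mulsgP[y z Hy Kz ->].
have [k1 e1] := tr1 y Hy; have [k2 e2] := tr2 z Kz.
pose k := chinese #|H| #|K| k1 k2; exists k.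
have [-> _] := @iterF (g1 * g2, a) k Gg Aa; rewrite FE /=.
have per (L : {group hT}) u i j : u \in affine_cycles L -> i = j %[mod #|L|] ->
    iter i (affine u) 1 = iter j (affine u) 1.
  move=> Xu eij; rewrite (divn_eq i #|L|) (divn_eq j #|L|) -eij.
  rewrite addnC iterD [in RHS]addnC iterD.
  have e m : iter (m * #|L|) (affine u) 1 = 1.
    by apply/eqP; rewrite (iter_affine_eq1 _ Xu) dvdn_mull.
  by rewrite !e.
rewrite e1 e2; congr (_ * _); apply/esym.
  by apply: (per _ _ _ _ X1); apply: chinese_modl.
by apply: (per _ _ _ _ X2); apply: chinese_modr.
Qed.

End CoprimeProductCount.

(** * The Hull-Dobell criterion and cyclic groups *)

Local Open Scope nat_scope.

(** The [k]-th iterate of [x |-> a x + b] sends 0 to [b * geom a k]. *)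
Definition geom (a k : nat) : nat := \sum_(i < k) a ^ i.

Lemma geom0 a : geom a 0 = 0.
Proof. by rewrite /geom big_ord0. Qed.

Lemma geomS a k : geom a k.+1 = a * geom a k + 1.
Proof.
rewrite /geom big_ord_recl expn0 addnC big_distrr /=; congr (_ + _).
by apply: eq_bigr => i _; rewrite expnS.
Qed.

Lemma geomSr a k : geom a k.+1 = geom a k + a ^ k.
Proof. by rewrite /geom big_ord_recr. Qed.

Lemma geomD a k l : geom a (k + l) = geom a k + a ^ k * geom a l.
Proof.
elim: l => [|l IHl]; first by rewrite addn0 geom0 muln0 addn0.
by rewrite addnS !geomSr IHl mulnDr addnA expnD.
Qed.

Lemma geomM a k l : geom a (k * l) = geom a k * geom (a ^ k) l.
Proof.
elim: l => [|l IHl]; first by rewrite muln0 !geom0 muln0.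
by rewrite mulnS addnC geomD IHl geomSr mulnDr -expnM [_ ^ _ * _]mulnC.
Qed.

Lemma geom_modn_1 d a k : a = 1 %[mod d] -> geom a k = k %[mod d].
Proof.
move=> a1; elim: k => [|k IHk]; first by rewrite geom0.
rewrite geomS -modnDml -modnMml a1 modnMml mul1n modnDml.
by rewrite -modnDml IHk modnDml addn1.
Qed.

(** The quotient ((1 + pb)^k - 1)/(pb) expanded to first order in p. At [k = p] odd the middle term
    is divisible by p^2, so [p] divides the sum exactly once. *)
Lemma geom_expansion p b k : exists t,
  geom (1 + p * b) k = k + p * b * 'C(k, 2) + p ^ 2 * t.
Proof.
elim: k => [|k [t IHk]]; first by exists 0; rewrite geom0 bin0n !muln0.
exists (t + b * b * 'C(k, 2) + p * b * t).
rewrite geomS IHk binS bin1; ring.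
Qed.

(** Lifting the exponent: [p] divides [k], and for [k = p * k'] the sum factors as
    [geom a p * geom (a ^ p) k'], whose first factor contains [p] exactly once. For [p = 2] that
    factor is [1 + a], which is why [a] must be 1 modulo 4. *)
Lemma prime_pow_dvd_geom p j a k : prime p -> a = 1 %[mod p] ->
  (p = 2 -> 1 < j -> a = 1 %[mod 4]) -> p ^ j %| geom a k -> p ^ j %| k.
Proof.
move=> pr_p; elim: j a k => [|j IHj] a k ap a4 dvS; first by rewrite dvd1n.
have /dvdnP[k' def_k] : p %| k.
  rewrite /dvdn -(geom_modn_1 k ap) -/(dvdn _ _).
  by apply: dvdn_trans dvS; rewrite expnS dvdn_mulr.
case: j => [|j] in IHj a4 dvS *; first by rewrite expn1 def_k dvdn_mull.
have p_gt0 := prime_gt0 pr_p.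
have [c def_c c1] : exists2 c, geom a p = p * c & coprime p c.
  have [p2|odd_p] := even_prime pr_p.
    rewrite p2 in a4 *; have {}a4 := a4 erefl isT.
    (* With [a = 4q + 1] the sum [1 + a] is [2 * (2q + 1)]. *)
    exists (a %/ 4).*2.+1; last by rewrite coprime2n /= odd_double.
    rewrite /geom !big_ord_recr big_ord0 /= expn0 expn1 {1}(divn_eq a 4) a4.
    by rewrite modn_small // -(addn1 (_.*2)) -mul2n; ring.
  have [b def_a] : exists b, a = 1 + p * b.
    exists (a %/ p); rewrite {1}(divn_eq a p) ap modn_small ?prime_gt1 //.
    by rewrite addnC mulnC.
  have [t ->] : exists t, geom a p = p + p * b * 'C(p, 2) + p ^ 2 * t.
    by rewrite def_a; apply: geom_expansion.
  exists (1 + p * (b * p.-1./2 + t)); first by rewrite bin2odd //; ring.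
  by rewrite /coprime addnC mulnC gcdnMDl gcdn1.
rewrite def_k mulnC expnS dvdn_pmul2l //.
apply: (IHj (a ^ p)).
- by rewrite -modnXm ap modnXm exp1n.
- by move=> p2 _; rewrite -modnXm (a4 p2 isT) modnXm exp1n.
move: dvS; rewrite def_k mulnC geomM def_c expnS -mulnA dvdn_pmul2l //.
by rewrite Gauss_dvdr // coprimeXl.
Qed.

(* The modulus of the Hull-Dobell criterion: an affine map [x -> a x + b] of
   [Z/m] is an [m]-cycle iff [b] is a unit and [a = 1] modulo [hd_modulus m]. *)
Definition hd_exp (m p : nat) : nat := if (p == 2) && (4 %| m) then 2 else 1.

Definition hd_modulus (m : nat) : nat := \prod_(p <- primes m) p ^ hd_exp m p.

Lemma hd_modulusE m : 0 < m ->
  hd_modulus m = (if 4 %| m then 2 * radical m else radical m).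
Proof.
move=> m_gt0; rewrite /hd_modulus /radical /hd_exp; case: ifP => m4; last first.
  by apply: eq_bigr => p _; rewrite andbF.
have m2 : 2 \in primes m by rewrite mem_primes m_gt0 (dvdn_trans _ m4).
rewrite (bigD1_seq 2) ?primes_uniq //= [in RHS](bigD1_seq 2) ?primes_uniq //=.
rewrite mulnA; congr (_ * _); apply: eq_bigr => p /negPf->.
by rewrite expn1.
Qed.

Lemma prod_prime_pow_dvd (s : seq nat) (e : nat -> nat) d :
    uniq s -> all prime s ->
  (\prod_(p <- s) p ^ e p %| d) = all (fun p => p ^ e p %| d) s.
Proof.
elim: s => [|p s IHs] /=; first by rewrite big_nil dvd1n.
case/andP=> s'p Us /andP[pr_p pr_s]; rewrite big_cons Gauss_dvd ?IHs //.
rewrite big_seq; elim/big_rec: _ => [|q x sq IHx]; first by rewrite coprimen1.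
rewrite coprimeMr IHx andbT; apply/coprimeXl/coprimeXr.
rewrite prime_coprime // dvdn_prime2 ?(allP pr_s q) //.
by apply: contraNneq s'p => ->.
Qed.

Lemma hd_modulus_dvd m d :
  (hd_modulus m %| d) = all (fun p => p ^ hd_exp m p %| d) (primes m).
Proof.
apply: prod_prime_pow_dvd; first exact: primes_uniq.
by apply/allP=> p; rewrite mem_primes => /andP[].
Qed.

Lemma hd_modulus_dvdn m : hd_modulus m %| m.
Proof.
rewrite hd_modulus_dvd; apply/allP=> p; rewrite mem_primes => /and3P[_ _ pm].
rewrite /hd_exp; case: andP => [[/eqP-> //]|_]; exact: pm.
Qed.

Lemma hd_modulus_coprime m a :
  0 < m -> 0 < a -> hd_modulus m %| a.-1 -> coprime a m.
Proof.
move=> m_gt0 a_gt0; rewrite hd_modulus_dvd => /allP hda.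
rewrite coprime_sym; apply/negPn/negP=> /negPf nco.
have gt1 : 1 < gcdn m a.
  by rewrite ltn_neqAle gcdn_gt0 m_gt0 andbT eq_sym -[_ == _]/(coprime m a) nco.
set p := pdiv (gcdn m a); have pr_p : prime p by apply: pdiv_prime.
have [pm pa] : p %| m /\ p %| a by apply/andP; rewrite -dvdn_gcd pdiv_dvd.
have pP : p \in primes m by rewrite mem_primes pr_p m_gt0.
have pa1 : p %| a.-1.
  apply: dvdn_trans (hda p pP); rewrite /hd_exp.
  by case: ifP => _; rewrite ?expn1 // dvdn_mulr.
move: pa; rewrite -(prednK a_gt0) -addn1 dvdn_addr // dvdn1 => /eqP p1.
by rewrite p1 in pr_p.
Qed.

Lemma modn1_predn d a : 0 < a -> (a == 1 %[mod d]) = (d %| a.-1).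
Proof. by move=> a_gt0; rewrite eqn_mod_dvd // subn1. Qed.

Lemma dvd_geom m a k : 0 < m -> 0 < a -> hd_modulus m %| a.-1 ->
  m %| geom a k -> m %| k.
Proof.
move=> m_gt0 a_gt0; rewrite hd_modulus_dvd => /allP hda dvS.
apply/dvdn_partP=> // p pm; have := hda p pm; rewrite /hd_exp => {}hda.
have pr_p : prime p by move: pm; rewrite mem_primes => /andP[].
rewrite p_part; apply: (@prime_pow_dvd_geom p _ a) => //.
- apply/eqP; rewrite modn1_predn //; apply: dvdn_trans hda.
  by case: ifP => _; rewrite ?expn1 // dvdn_mulr.
- move=> p2 lt1; apply/eqP; rewrite modn1_predn //.
  move: hda; rewrite p2 eqxx /= ifT //.
  by rewrite -[4]/(2 ^ 2) pfactor_dvdn //; rewrite p2 in lt1.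
by apply: dvdn_trans dvS; rewrite -p_part dvdn_part.
Qed.

(** Equal values at steps [i <= j] make [m] divide [b * a ^ i * geom a (j - i)], hence [j - i]. The
    first [m] iterates are therefore distinct and exhaust the residues. *)
Lemma lcg_full m a b : 0 < m -> 0 < a -> coprime b m -> hd_modulus m %| a.-1 ->
  forall y, exists k, b * geom a k = y %[mod m].
Proof.
move=> m_gt0 a_gt0 cobm hda y.
have coam := hd_modulus_coprime m_gt0 a_gt0 hda.
pose f (i : 'I_m) := Ordinal (ltn_pmod (b * geom a i) m_gt0).
have injf : injective f.
  move=> i j; wlog le_ij : i j / i <= j => [W eq_f|].
    by case/orP: (leq_total i j) => le; [|apply/esym]; apply: W.
  move/(congr1 val)/eqP => /=; rewrite eq_sym -{1}(subnKC le_ij) geomD mulnDr.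
  rewrite -{2}[b * geom a i]addn0 eqn_modDl mod0n -/(dvdn _ _).
  rewrite mulnA Gauss_dvdr; last first.
    by rewrite coprimeMr coprime_sym cobm coprimeXr // coprime_sym.
  move/(dvd_geom m_gt0 a_gt0 hda) => dvm; apply/val_inj/eqP.
  rewrite /= eqn_leq le_ij /= -subn_eq0.
  have := dvdn_leq _ dvm.
  case: (j - i) (ltn_ord j) (leq_subr i j) => // d ltj lej /(_ isT).
  by rewrite leqNgt (leq_ltn_trans lej ltj).
have /codomP[i ei] : Ordinal (ltn_pmod y m_gt0) \in codom f by apply: injF_onto.
by exists i; have /(congr1 val) := ei => /= ->.
Qed.

(** Here [a] is -1 modulo 4, so the sums alternate between 1 and 0: this is the source of the
    exponent 2 in [hd_exp]. *)
Lemma geom_mod4 a k : a = 3 %[mod 4] -> geom a k = odd k %[mod 4].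
Proof.
move=> a3; elim: k => [|k IHk]; first by rewrite geom0.
rewrite geomS -modnDml -modnMm a3 IHk modnMm modnDml /=.
by case: (odd k).
Qed.

Lemma eq_mod_dvdn d m x y : d %| m -> x = y %[mod m] -> x = y %[mod d].
Proof. by move=> dm e; rewrite -(modn_dvdm x dm) e modn_dvdm. Qed.

Lemma lcg_full_inv m a b : 0 < m -> 0 < a -> coprime a m ->
    (forall y, exists k, b * geom a k = y %[mod m]) ->
  coprime b m /\ hd_modulus m %| a.-1.
Proof.
move=> m_gt0 a_gt0 coam full.
have cobm : coprime b m.
  have [k ek] := full 1; rewrite coprime_sym /coprime -dvdn1.
  have /eq_mod_dvdn-/(_ _ _ ek) e1 := dvdn_gcdl m b.
  by rewrite /dvdn -e1 -/(dvdn _ _) dvdn_mulr // dvdn_gcdr.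
split=> //; rewrite hd_modulus_dvd; apply/allP=> p.
rewrite mem_primes m_gt0 /= => /andP[pr_p pm].
have pNa : ~~ (p %| a) by rewrite -prime_coprime // coprime_sym (coprime_dvdr pm).
have pNb : ~~ (p %| b) by rewrite -prime_coprime // coprime_sym (coprime_dvdr pm).
have p_gt0 := prime_gt0 pr_p.
(* If [p] does not divide [a - 1], then [y = b / (1 - a)] is a fixed point mod p. *)
have pa1 : p %| a.-1.
  apply/negPn/negP; rewrite -prime_coprime // => cop.
  have [w _] := Bezoutl a.-1 p_gt0; rewrite (eqP cop) => pw.
  have [k /(eq_mod_dvdn pm) ek] := full (w * b).
  (* [b * a ^ k] is the step from the [k]-th orbit point to the next one. At the fixed point [w * b]
     it vanishes modulo [p], although [p] divides neither [a] nor [b]. *)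
  have : p %| b * a ^ k.
    have -> : b * a ^ k = b + b * geom a k * a.-1.
      rewrite -mulnA [geom a k * _]mulnC -predn_exp -mulnS prednK //.
      by rewrite expn_gt0 a_gt0.
    rewrite /dvdn -modnDmr -modnMml ek modnMml modnDmr.
    have -> : b + w * b * a.-1 = b * (1 + w * a.-1) by ring.
    by rewrite -/(dvdn _ _) dvdn_mull.
  by rewrite Euclid_dvdM // (negPf pNb) Euclid_dvdX // (negPf pNa).
rewrite /hd_exp; case: andP => [[/eqP p2 m4]|_]; last by rewrite expn1.
rewrite p2 -modn1_predn //; apply/eqP.
have a_odd : odd a by rewrite -[odd a]negbK -dvdn2 -p2.
have [a3|//] : a = 3 %[mod 4] \/ a = 1 %[mod 4].
  rewrite [X in _ = X \/ _]modn_small // [X in _ \/ _ = X]modn_small //.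
  move: a_odd (ltn_pmod a (isT : 0 < 4)); rewrite {1}(divn_eq a 4) oddD oddM andbF /=.
  by case: (a %% 4) => [|[|[|[|]]]] // _ _; [right|left].
(* The only values of [b * geom a k] modulo 4 are 0 and the odd [b], so 2 is missed. *)
have [k /(eq_mod_dvdn m4)] := full 2.
rewrite -modnMmr geom_mod4 // modnMmr; move: pNb; rewrite p2 dvdn2 negbK => b_odd.
case: (odd k) => //=; last by rewrite muln0.
rewrite muln1 => /(congr1 odd); rewrite [2 %% 4]modn_small // => e.
by move: b_odd; rewrite (divn_eq b 4) oddD oddM andbF /= e.
Qed.

Local Open Scope group_scope.

(** * Affine cycles of a cyclic group *)

Section CyclicCount.

Variables (hT : finGroupType) (x : hT).
Implicit Types (a : {perm hT}) (y g : hT).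

Lemma Aut_cycle_exists y : <[y]> = <[x]> -> exists2 a, a \in Aut <[x]> & a x = y.
Proof.
move=> defy; have oxy : #[y] = #[x] by rewrite !orderE defy.
have dvd : #[y] %| #[x] by rewrite oxy.
have inje : 'injm (eltm dvd) by rewrite injm_eltm oxy.
have ime : eltm dvd @* <[x]> = <[x]> by rewrite im_eltm defy.
exists (aut inje ime); first exact: Aut_aut.
by rewrite autE ?cycle_id //; apply: eltm_id.
Qed.

Lemma Aut_cycle_inj : {in Aut <[x]> &, injective (fun a : {perm hT} => a x)}.
Proof.
move=> a b Aa Ab eab; apply: (eq_Aut Aa Ab) => _ /cycleP[i ->].
by rewrite (AutX _ Aa) ?(AutX _ Ab) ?cycle_id //= eab.
Qed.

Lemma iter_affine_cycle a b c k : a \in Aut <[x]> -> a x = x ^+ c ->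
  iter k (affine (x ^+ b, a)) 1 = x ^+ (b * geom c k).
Proof.
move=> Aa eac; elim: k => [|k IHk] /=; first by rewrite geom0 muln0.
rewrite IHk /affine /= (AutX _ Aa) ?cycle_id // eac -expgM -expgD.
by rewrite geomS mulnDr muln1 mulnCA.
Qed.

Let m := #[x].

(** On exponents the affine map is [y |-> c y + b], where [a x = x ^+ c]. The condition that
    [hd_modulus m] divides [c - 1] is phrased as membership in a subgroup, whose order then counts
    the automorphisms. *)
Lemma affine_cycles_cycle : affine_cycles <[x]> =
  setX [set g | generator <[x]> g]
       [set a in Aut <[x]> | x^-1 * a x \in <[x ^+ hd_modulus m]>].
Proof.
have m_gt0 : 0 < m by apply: order_gt0.
apply/setP=> -[g a]; rewrite in_setX inE [a \in _]inE /=.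
case Aa : (a \in Aut <[x]>); last first.
  by rewrite andbF; apply/negP=> /affine_cyclesP[]; rewrite Aa.
case xg : (g \in <[x]>); last first.
  apply/idP/idP => [/affine_cyclesP[]|/andP[]]; rewrite /= ?xg //.
  by rewrite /generator => /eqP e; rewrite e cycle_id in xg.
have /cycleP[b def_g] := xg.
have [c c_gt0 eac] : exists2 c, 0 < c & a x = x ^+ c.
  have /cycleP[c ec] : a x \in <[x]> by apply: Aut_closed Aa _ (cycle_id x).
  by exists (c + m)%N; rewrite ?addn_gt0 ?m_gt0 ?orbT // expgD expg_order mulg1.
have cocm : coprime c m.
  rewrite coprime_sym -generator_coprime -eac.
  rewrite /generator eq_sym; have := im_autm Aa.
  by rewrite morphim_cycle ?cycle_id //= autmE => ->.
have -> : (x^-1 * a x \in <[x ^+ hd_modulus m]>) = (hd_modulus m %| c.-1).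
  rewrite eac -{1}(prednK c_gt0) expgS mulKg.
  apply/cycleP/idP=> [[i]|/dvdnP[i ->]]; last first.
    by exists i; rewrite mulnC expgM.
  rewrite -expgM => /eqP; rewrite eq_expg_mod_order => /eqP e.
  rewrite /dvdn (eq_mod_dvdn (hd_modulus_dvdn m) e).
  by rewrite -/(dvdn _ _) dvdn_mulr.
have -> : generator <[x]> g = coprime b m.
  by rewrite def_g generator_coprime coprime_sym.
apply/affine_cyclesP/andP=> [[/= _ _ tr]|[cobm hdc]].
  apply: lcg_full_inv => // y; have [k] := tr (x ^+ y) (mem_cycle x y).
  rewrite def_g (iter_affine_cycle _ _ Aa eac) => /eqP.
  by rewrite eq_expg_mod_order eq_sym => /eqP; exists k.
split=> // _ /cycleP[y ->]; have [k ek] := lcg_full m_gt0 c_gt0 cobm hdc y.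
exists k; rewrite def_g (iter_affine_cycle _ _ Aa eac); apply/eqP.
by rewrite eq_expg_mod_order ek.
Qed.

(** The choice of the constant, a generator, gives the factor [#|Aut <[x]>|]. The automorphisms are
    counted by the bijection [a |-> x^-1 * a x] onto [<[x ^+ hd_modulus m]>]; it is onto because an
    exponent that is 1 modulo [hd_modulus m] is coprime to [m]. *)
Lemma card_affine_cycles_cycle :
  #|affine_cycles <[x]>| = (m %/ hd_modulus m * #|Aut <[x]>|)%N.
Proof.
have m_gt0 : 0 < m by apply: order_gt0.
rewrite affine_cycles_cycle cardsX -totient_gen card_Aut_cycle mulnC; congr (_ * _)%N.
rewrite -(orderXdiv (hd_modulus_dvdn m)) orderE.
rewrite -(@card_in_imset _ _ (fun a : {perm hT} => x^-1 * a x)); last first.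
  move=> a b /setIdP[Aa _] /setIdP[Ab _] /mulgI; exact: Aut_cycle_inj.
congr #|pred_of_set _|; apply/setP=> h; apply/imsetP/idP=> [[a]|xh].
  by case/setIdP=> Aa ? ->.
have /cycleP[i eh] := xh.
have defxh : <[x * h]> = <[x]>.
  apply/esym/eqP; rewrite -[_ == _]/(generator <[x]> (x * h)) eh -expgM -expgS.
  rewrite generator_coprime coprime_sym.
  by apply: hd_modulus_coprime => //=; rewrite dvdn_mulr.
have [a Aa eax] := Aut_cycle_exists defxh.
by exists a; [apply/setIdP; rewrite eax mulKg | rewrite eax mulKg].
Qed.

End CyclicCount.

Lemma card_affine_cycles_cyclic (hT : finGroupType) (G : {group hT}) : cyclic G ->
  #|affine_cycles G| = (#|G| %/ hd_modulus #|G| * #|Aut G|)%N.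
Proof. by case/cyclicP=> x ->; apply: card_affine_cycles_cycle. Qed.

(** * Factorizations of p-groups *)

(* [H] models [T ><| <[a]>] and [s] the affine map: [A] is the point stabiliser
   and transitivity of [<[s]>] reads [H = A <[s]>]. *)
Definition cyclic_factorization (gT : finGroupType) (p : nat)
    (H T A : {group gT}) (s : gT) : Prop :=
  [/\ p.-group H, T <| H, T * A = H, T :&: A = 1
    & s \in H /\ H \subset A * <[s]>].

Section Factorization.

Variables (gT : finGroupType) (p : nat).
Implicit Types (H T A M W : {group gT}) (s : gT).

Lemma cyclic_factorization_quotient H T A s W :
    cyclic_factorization p H T A s -> W <| H -> W \subset T ->
  cyclic_factorization p (H / W)%G (T / W)%G (A / W)%G (coset W s).
Proof.
case=> pH nsTH defH tiTA [Hs sH] nsWH sWT.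
have sAH : A \subset H by rewrite -defH mulG_subr.
have nWH := normal_norm nsWH; have nWA := subset_trans sAH nWH.
have nWT := subset_trans (normal_sub nsTH) nWH.
have nWs := subsetP nWH s Hs.
split; first exact: quotient_pgroup.
- exact: quotient_normal.
- by rewrite /= -quotientMl // defH.
- by rewrite /= -quotientGI // tiTA quotient1.
split; first exact: mem_quotient.
by rewrite /= -quotient_cycle // -quotientMl // quotientS.
Qed.

(** [<[s]>] is transitive on the [#|T|] cosets of [A]. If [s ^+ k] fixes the coset [A], its orbit
    has at most [k] points. *)
Lemma cyclic_factorization_leq H T A s k :
  cyclic_factorization p H T A s -> 0 < k -> s ^+ k \in A -> #|T| <= k.
Proof.
case=> pH nsTH defH tiTA [Hs sH] k_gt0 Ask.
have oH : #|H| = (#|T| * #|A|)%N by rewrite -defH TI_cardMg.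
have A_gt0 := cardG_gt0 A.
have le1 : #[s] <= k * #|A :&: <[s]>|.
  have le2 : #[s ^+ k] <= #|A :&: <[s]>|.
    by rewrite subset_leq_card // subsetI !cycle_subG Ask mem_cycle.
  apply: leq_trans (leq_mul (leqnn k) le2); rewrite orderXgcd.
  have dvg := dvdn_gcdl #[s] k; rewrite -{1}(divnK dvg) mulnC leq_mul //.
  by rewrite dvdn_leq // dvdn_gcdr.
rewrite -(leq_pmul2r A_gt0) -oH.
rewrite -(leq_pmul2r (cardG_gt0 (A :&: <[s]>))).
apply: leq_trans (leq_mul (subset_leq_card sH) (leqnn _)) _.
by rewrite -mul_cardG -orderE mulnAC mulnC leq_mul.
Qed.

(** In a nilpotent group commutation with [H] strictly shrinks a nontrivial normal subgroup, and
    order p^2 leaves room for two such steps only. *)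
Lemma comm3_p2_group H M : prime p -> p.-group H -> M <| H -> #|M| = (p ^ 2)%N ->
  [~: M, H, H] = 1.
Proof.
move=> pr_p pH nsMH oM; have nilH := pgroup_nil pH.
have [sMH nMH] := andP nsMH; have p_gt1 := prime_gt1 pr_p.
have lt_comm (K : {group gT}) i : K <| H -> #|K| = (p ^ i.+1)%N ->
    exists2 j, j <= i & #|[~: K, H]| = (p ^ j)%N.
  move=> nsKH oK; have [sKH nKH] := andP nsKH.
  have ntK : K :!=: 1 by rewrite -cardG_gt1 oK -(exp1n i.+1) ltn_exp2r.
  have pr : [~: K, H] \proper K.
    by apply: (nil_comm_properl nilH sKH ntK); rewrite subsetI subxx.
  have /p_natP[j oj] := pgroupS (subset_trans (proper_sub pr) sKH) pH.
  exists j => //; have := proper_card pr; rewrite oj oK ltn_exp2l //.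
have [j j_le oj] := lt_comm M 1%N nsMH oM.
case: j => [|j] in j_le oj.
  by rewrite (card1_trivg oj) comm1G.
have nsRH : [~: M, H] <| H.
  by rewrite /normal commg_normr andbT (subset_trans _ sMH) // commg_subl.
have [k k_le ok] := lt_comm [~: M, H]%G j nsRH oj.
have k0 : k = 0 by case: j j_le k k_le {oj ok} => // _ [].
by apply: card1_trivg; rewrite ok k0.
Qed.

(** Write [s = t * a]. As [[~ a, t]] is central in [H], s^p is t^p a^p times a power of [[~ a, t]]
    with exponent C(p, 2). Both extra factors vanish, so s^p lies in [A], whereas transitivity would
    need p^2 points. *)
Lemma no_factorization_odd H T A s : prime p -> odd p ->
  cyclic_factorization p H T A s -> p.-abelem T -> #|T| <> (p ^ 2)%N.
Proof.
move=> pr_p odd_p fact abT oT; have [pH nsTH defH tiTA [Hs sH]] := fact.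
have p_gt1 := prime_gt1 pr_p.
have c3 := comm3_p2_group pr_p pH nsTH oT.
have [sTH nTH] := andP nsTH; have sAH : A \subset H by rewrite -defH mulG_subr.
have /mulsgP[t a Tt Aa def_s] : s \in T * A by rewrite defH.
have Ha := subsetP sAH a Aa; have Ht := subsetP sTH t Tt.
have Rat : [~ a, t] \in [~: T, H] by rewrite commGC mem_commg.
have cRH : [~: T, H] \subset 'C(H) by apply/commG1P.
have cat := centP (subsetP cRH _ Rat).
have TRat : [~ a, t] \in T by apply: subsetP Rat; rewrite commg_subl.
have exT y : y \in T -> y ^+ p = 1 by case/(abelemP pr_p): abT => _; apply.
have sp : s ^+ p = a ^+ p.
  rewrite def_s expMg_Rmul; try by apply/commute_sym; apply: cat.
  by rewrite (exT t Tt) mul1g bin2odd // expgM (exT _ TRat) expg1n mulg1.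
have := @cyclic_factorization_leq _ _ _ _ p fact (ltnW p_gt1).
rewrite sp groupX // oT => /(_ isT).
by rewrite -{2}(expn1 p) leq_exp2l.
Qed.

(** [M / 'Phi(M)] is elementary abelian of rank at least 2, because [M] is not cyclic. A subgroup of
    corank 2 in it, normal in [H / 'Phi(M)], is lifted to [W]. *)
Lemma exists_normal_p2_quotient H M : p.-group H -> M <| H -> ~~ cyclic M ->
  exists W : {group gT}, [/\ W <| H, W \subset M, p.-abelem (M / W)
                          & #|M / W| = (p ^ 2)%N].
Proof.
move=> pH nsMH ncM; have sMH := normal_sub nsMH; have pM := pgroupS sMH pH.
have nsPH : 'Phi(M) <| H by apply: char_normal_trans (Phi_char M) nsMH.
have abP := Phi_quotient_abelem pM.
have ncP : ~~ cyclic (M / 'Phi(M)) by apply: contra ncM; apply: Phi_quotient_cyclic.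
rewrite (abelem_cyclic abP) -ltnNge in ncP.
have [Q [sQM nsQH oQ]] := normal_pgroup (quotient_pgroup _ pH)
   (quotient_normal 'Phi(M) nsMH) (leq_subr 2 (logn p #|M / 'Phi(M)|)).
have [W defQ sPW nsWH] := inv_quotientN nsPH nsQH.
have sWM : W \subset M.
  rewrite -(quotientSGK _ (Phi_sub M)) -?defQ //.
  by rewrite (subset_trans _ (normal_norm nsPH)) ?(normal_sub nsWH).
have nsPM : 'Phi(M) <| M by apply: Phi_normal.
have nsWM : W <| M by apply: normalS nsWH.
have iso := third_isog sPW nsPM nsWM.
exists W; split=> //; first by rewrite -(isog_abelem iso) quotient_abelem.
rewrite -(card_isog iso) card_quotient ?quotient_norms ?normal_norm //.
have oWP : #|W / 'Phi(M)| = #|Q| by rewrite defQ.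
rewrite -divgS ?quotientS //= oWP oQ.
have oMP : #|M / 'Phi(M)| = (p ^ logn p #|M / 'Phi(M)|)%N.
  by rewrite -p_part part_pnat_id //; apply: abelem_pgroup abP.
have p_gt0 : 0 < p.
  by move: ncP; rewrite lognE; case: (prime p) / boolP => // /prime_gt0.
by rewrite {1}oMP -{1}(subnK ncP) expnD mulKn // expn_gt0 p_gt0.
Qed.

End Factorization.

Lemma factorization_odd_cyclic (gT : finGroupType) p (H T A : {group gT}) s :
    prime p -> odd p ->
  cyclic_factorization p H T A s -> cyclic T.
Proof.
move=> pr_p odd_p fact; have [pH nsTH _ _ _] := fact.
apply: contraT => ncT.
have [W [nsWH sWT abW oW]] := exists_normal_p2_quotient pH nsTH ncT.
have factW := cyclic_factorization_quotient fact nsWH sWT.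
by case: (no_factorization_odd pr_p odd_p factW abW).
Qed.

(** [s ^+ 2] centralises [M], since conjugating [y] twice multiplies it by [[~ y, s] ^+ 2 = 1]. It
    also lies in [M A], of index 2 in [H], so [s ^+ 2 = m * a] with commuting factors and
    [s ^+ 4 = a ^+ 2] is in [A]: at most 4 points are reached out of 8. *)
Lemma no_factorization_2 (gT : finGroupType) (H T A M : {group gT}) s :
    cyclic_factorization 2 H T A s -> M <| H -> M \subset T -> 2.-abelem M ->
  #|M| = 4 -> #|T| <> 8.
Proof.
move=> fact nsMH sMT abM oM oT; have [pH nsTH defH tiTA [Hs sH]] := fact.
have c3 := comm3_p2_group (isT : prime 2) pH nsMH oM.
have [sMH nMH] := andP nsMH; have sAH : A \subset H by rewrite -defH mulG_subr.
have exM y : y \in M -> y ^+ 2 = 1 by case/(abelemP (isT : prime 2)): abM => _; apply.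
have cs2 y : y \in M -> commute y (s ^+ 2).
  move=> My; have Ry : [~ y, s] \in [~: M, H] by rewrite mem_commg.
  have cRH : [~: M, H] \subset 'C(H) by apply/commG1P.
  have cys := centP (subsetP cRH _ Ry) s Hs.
  have MRy : [~ y, s] \in M by apply: subsetP Ry; rewrite commg_subl.
  apply/commgP/conjg_fixP; rewrite expgS expg1 conjgM (conjg_mulR y s) conjMg.
  rewrite (conjg_mulR y s) /conjg cys mulKg -mulgA -[X in _ * X]/([~ y, s] ^+ 2).
  by rewrite exM // mulg1.
have defMA : M <*> A = M * A by rewrite norm_joinEr // (subset_trans sAH).
have tiMA : M :&: A = 1 by apply/trivgP; rewrite -tiTA setSI.
have oMA : #|M <*> A| = (4 * #|A|)%N by rewrite defMA TI_cardMg // oM.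
have oH : #|H| = (8 * #|A|)%N by rewrite -defH TI_cardMg // oT.
have sMAH : M <*> A \subset H by rewrite join_subG sMH.
have iMA : #|H : M <*> A| = 2.
  rewrite -divgS // oMA oH -[8]/(2 * 4)%N -mulnA mulnK //.
  by rewrite muln_gt0 cardG_gt0.
have nsMA := index2_normal sMAH iMA.
have s2 : s ^+ 2 \in M <*> A.
  have nMAs := subsetP (normal_norm nsMA) s Hs.
  rewrite coset_idr ?groupX // morphX //=.
  rewrite -iMA -card_quotient ?normal_norm // expg_cardG //.
  exact: mem_quotient.
rewrite defMA in s2; have /mulsgP[m a Mm Aa def_s2] := s2.
have cma : commute m a.
  have -> : a = m^-1 * s ^+ 2 by rewrite def_s2 mulKg.
  by apply: commuteM; [apply/commuteV | apply: cs2].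
have s4 : s ^+ 4 = a ^+ 2.
  by rewrite -[4]/(2 * 2)%N expgM def_s2 expgMn // (exM m Mm) mul1g.
have := @cyclic_factorization_leq _ _ _ _ _ _ 4 fact isT.
by rewrite s4 groupX // oT => /(_ isT).
Qed.

Lemma factorization_2_maximal_cyclic (gT : finGroupType) (H T A M : {group gT}) s :
    cyclic_factorization 2 H T A s -> M <| H -> M \subset T -> #|T : M| = 2 ->
  cyclic M.
Proof.
move=> fact nsMH sMT iM; have [pH nsTH _ _ _] := fact.
apply: contraT => ncM.
have [W [nsWH sWM abW oW]] := exists_normal_p2_quotient pH nsMH ncM.
have factW := cyclic_factorization_quotient fact nsWH (subset_trans sWM sMT).
case: (no_factorization_2 factW (quotient_normal W nsMH) _ abW oW).
  exact: quotientS.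
have nWT := subset_trans (normal_sub nsTH) (normal_norm nsWH).
rewrite /= -(Lagrange (quotientS W sMT)) oW index_quotient_eq ?iM //.
by rewrite subIset // sWM orbT.
Qed.

(** * From affine cycles of p-groups to factorizations *)

Section AffineFactorization.

Variables (hT : finGroupType) (G : {group hT}) (p : nat).
Variable u : hT * {perm hT}.
Hypotheses (pG : p.-group G) (Xu : u \in affine_cycles G).

Let to := [Aut G]%gact.
Let Gg : u.1 \in G. Proof. by case/affine_cyclesP: Xu. Qed.
Let Aa : u.2 \in Aut G. Proof. by case/affine_cyclesP: Xu. Qed.
Let T := (sdpair1 to @* G)%G.
Let A := (sdpair2 to @* <[u.2]>)%G.
Let s : sdprod_by to := sdpair2 to u.2 * sdpair1 to u.1.
Let H := (T <*> A)%G.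

Let sAA : <[u.2]> \subset Aut G. Proof. by rewrite cycle_subG. Qed.
Let nTA : A \subset 'N(T).
Proof. by apply: subset_trans (im_sdpair_norm to); apply: morphimS. Qed.
Let defH : T * A = H. Proof. by rewrite /= norm_joinEr. Qed.
Let sdJ x a : x \in G -> a \in Aut G ->
  sdpair1 to (a x) = sdpair1 to x ^ sdpair2 to a.
Proof. by move=> Gx Ga; rewrite -sdpair_act. Qed.

Let s_expg k :
  s ^+ k = sdpair2 to (u.2 ^+ k) * sdpair1 to (iter k (affine u) 1).
Proof.
elim: k => [|k IHk]; first by rewrite !expg0 !morph1 mulg1.
have Gk := affine_iter_in k Gg Aa.
set x := iter k (affine u) 1 in Gk IHk *; rewrite expgSr IHk iterS -/x.
have -> : sdpair1 to (affine u x) = sdpair1 to x ^ sdpair2 to u.2 * sdpair1 to u.1.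
  rewrite -sdJ //; apply: (morphM (sdpair1_morphism to)) => //.
  exact: Aut_closed.
have -> : sdpair2 to (u.2 ^+ k.+1) = sdpair2 to (u.2 ^+ k) * sdpair2 to u.2.
  rewrite expgSr; apply: (morphM (sdpair2_morphism to)) => //.
  exact: groupX.
by rewrite /s conjgE !mulgA mulgK.
Qed.

Lemma affine_cycle_factorization : cyclic_factorization p H T A s.
Proof.
have TAH := defH; split.
- rewrite /pgroup -defH TI_cardMg; last first.
    by apply/trivgP; rewrite -(im_sdpair_TI to) setIS // morphimS.
  rewrite /= !card_injm ?injm_sdpair1 ?injm_sdpair2 // pnatM [p.-nat _]pG /=.
  apply: pnat_dvd pG; rewrite -orderE order_dvdn.
  by rewrite (affine_cycle_aut_expg Xu).
- by rewrite /normal joing_subl join_subG normG nTA.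
- exact: defH.
- by apply/trivgP; rewrite -(im_sdpair_TI to) setIS // morphimS.
have As2 : sdpair2 to u.2 \in A by rewrite mem_morphim ?cycle_id.
have Hs : s \in H.
  by rewrite groupM // mem_gen // inE ?As2 ?orbT // mem_morphim.
(* As [H = A * T], it suffices to place [T] in [A * <[s]>]: by [s_expg] the [k]-th orbit point is
   the product of an element of [A] and [s ^+ k]. *)
split=> //; rewrite -defH -(normC nTA) -[X in X * <[s]>](mulGid A) -mulgA mulgS //.
apply/subsetP=> _ /morphimP[x _ Gx ->].
have [_ _ tr] := affine_cyclesP _ _ Xu; have [k ->] := tr x Gx.
apply/mulsgP; exists (sdpair2 to (u.2 ^+ k))^-1 (s ^+ k); rewrite ?mem_cycle //.
  by rewrite groupV mem_morphim ?mem_cycle // groupX.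
by rewrite s_expg mulKg.
Qed.

Lemma affine_cycle_invariant_normal (M : {group hT}) :
    M <| G -> {in M, forall x, u.2 x \in M} ->
  sdpair1 to @* M <| H /\ sdpair1 to @* M \subset T.
Proof.
case/andP=> sMG nMG uM; have sMT : sdpair1 to @* M \subset T by apply: morphimS.
split=> //; rewrite /normal (subset_trans sMT) ?joing_subl //= join_subG.
rewrite morphim_norms //= morphim_cycle //= cycle_subG.
apply/normP/eqP; rewrite eqEcard cardJg leqnn andbT.
apply/subsetP=> _ /imsetP[_ /morphimP[x Gx Mx ->] ->].
by rewrite -sdJ // mem_morphim ?uM ?Aut_closed.
Qed.

Lemma affine_cycle_odd_cyclic : prime p -> odd p -> cyclic G.
Proof.
move=> pr_p odd_p.
have := factorization_odd_cyclic pr_p odd_p affine_cycle_factorization.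
by rewrite (injm_cyclic (injm_sdpair1 to)).
Qed.

Lemma affine_cycle_2_maximal_cyclic (M : {group hT}) : p = 2 ->
  M <| G -> {in M, forall x, u.2 x \in M} -> #|G : M| = 2 -> cyclic M.
Proof.
move=> p2 nsMG uM iM; have sMG := normal_sub nsMG.
have [nsMH sMT] := affine_cycle_invariant_normal nsMG uM.
have fact := affine_cycle_factorization; rewrite p2 in fact.
have := factorization_2_maximal_cyclic fact nsMH sMT.
rewrite (injm_cyclic (injm_sdpair1 to)) //; apply.
by rewrite index_injm ?injm_sdpair1.
Qed.

(** [H] has a normal subgroup of index 2 in [T]. Pulled back to [G], its normalisation by [A]
    becomes invariance under [u.2]. *)
Lemma affine_cycle_exists_maximal : p = 2 -> 1 < #|G| ->
  exists M : {group hT}, [/\ M <| G, {in M, forall x, u.2 x \in M}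
                          & #|G : M| = 2].
Proof.
move=> p2 G_gt1; have fact := affine_cycle_factorization; rewrite p2 in fact.
have [pH nsTH _ _ _] := fact.
have [v oG] : exists v, #|G| = (2 ^ v.+1)%N.
  have := pG; rewrite p2 => /p_natP[[|v] oG]; last by exists v.
  by rewrite oG in G_gt1.
have oT : #|T| = (2 ^ v.+1)%N by rewrite card_injm ?injm_sdpair1.
have le_v : v <= logn 2 #|T| by rewrite oT pfactorK.
have [Q [sQT nsQH oQ]] := normal_pgroup pH nsTH le_v.
have [M sMG defQ] : exists2 M : {group hT}, M \subset G & Q :=: sdpair1 to @* M.
  exists (sdpair1 to @*^-1 Q)%G; first exact: subsetIl.
  by rewrite morphpreK.
have oM : #|M| = (2 ^ v)%N by rewrite -oQ defQ card_injm ?injm_sdpair1.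
have iM : #|G : M| = 2 by rewrite -divgS // oM oG expnS mulnK // expn_gt0.
exists M; split=> //; first exact: index2_normal.
move=> x Mx; have Gx := subsetP sMG x Mx.
have : sdpair1 to (u.2 x) \in Q.
  rewrite sdJ // memJ_norm; first by rewrite defQ mem_morphim.
  apply: (subsetP (normal_norm nsQH)).
  by rewrite mem_gen // inE mem_morphim ?cycle_id ?orbT.
rewrite defQ => /morphimP[y Gy My /(injmP (injm_sdpair1 to)) -> //].
exact: Aut_closed.
Qed.

End AffineFactorization.

(** * Structure of 2-groups with an affine cycle *)

Lemma Aut_char_closed (hT : finGroupType) (G K : {group hT}) (a : {perm hT}) :
  a \in Aut G -> K \char G -> {in K, forall x, a x \in K}.
Proof.
move=> Aa /charP[sKG chK] x Kx.
by rewrite -(chK _ (injm_autm Aa) (im_autm Aa)) -(autmE Aa) mem_morphim ?(subsetP sKG).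
Qed.

Lemma expg2_Phi (hT : finGroupType) (G : {group hT}) x :
  2.-group G -> x \in G -> x ^+ 2 \in 'Phi(G).
Proof.
move=> pG Gx; have nPx : x \in 'N('Phi(G)) by apply: (subsetP (gFnorm _ _)).
rewrite coset_idr ?groupX // morphX //=.
have /(abelemP (isT : prime 2))[_] := Phi_quotient_abelem pG; apply.
exact: mem_quotient.
Qed.

Lemma leq_order_sqr (hT : finGroupType) (x : hT) : #[x] <= #[x ^+ 2] * 2.
Proof.
rewrite orderXgcd; have dvg := dvdn_gcdl #[x] 2.
by rewrite -{1}(divnK dvg) leq_mul // dvdn_leq // dvdn_gcdr.
Qed.

Lemma Ohm1_cycle_sub (hT : finGroupType) (P Q : {group hT}) : 2.-group P ->
  cyclic P -> Q \subset P -> Q :!=: 1 -> 'Ohm_1(P) \subset Q.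
Proof.
move=> pP cP sQP ntQ; have pQ := pgroupS sQP pP; have cQ := cyclicS sQP cP.
have oQ := Ohm1_cyclic_pgroup_prime cQ pQ ntQ.
have ntP : P :!=: 1 by apply: contraNneq ntQ => P1; rewrite -subG1 -P1.
have oP := Ohm1_cyclic_pgroup_prime cP pP ntP.
apply: subset_trans (Ohm_sub 1 Q).
suff -> : 'Ohm_1(P) = 'Ohm_1(Q) by [].
by apply/esym/eqP; rewrite eqEcard OhmS // oP oQ.
Qed.

Lemma affine_cycle_2group_structure (hT : finGroupType) (G : {group hT}) u :
    2.-group G -> u \in affine_cycles G -> ~~ cyclic G ->
  (exists2 v, v > 1 & G \isog 'D_(2 ^ v)) \/ (exists2 v, v > 2 & G \isog 'Q_(2 ^ v)).
Proof.
move=> pG Xu ncG; have [_ Aa _] := affine_cyclesP _ _ Xu.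
have ntG : G :!=: 1 by apply: contraNneq ncG => ->; apply: cyclic1.
have [v oG] : exists v, #|G| = (2 ^ v.+2)%N.
  have /p_natP[[|[|v]] oG] := pG; last by exists v.
    by rewrite (card1_trivg oG) eqxx in ntG.
  by rewrite prime_cyclic ?oG in ncG.
have G_gt1 : 1 < #|G| by rewrite cardG_gt1.
have [M [nsMG uM iM]] := affine_cycle_exists_maximal pG Xu erefl G_gt1.
have cM := affine_cycle_2_maximal_cyclic pG Xu erefl nsMG uM iM.
have [sMG nMG] := andP nsMG.
have oM : #|M| = (2 ^ v.+1)%N.
  by apply/eqP; rewrite -(eqn_pmul2r (isT : 0 < 2)) -{1}iM Lagrange // oG -expnSr.
have ntM : M :!=: 1 by rewrite -cardG_gt1 oM (ltn_exp2l 0).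
have pM := pgroupS sMG pG.
have [m defM] := cyclicP cM; have Mm : m \in M by rewrite defM cycle_id.
have Pm2 : m ^+ 2 \in 'Phi(G) by apply: expg2_Phi; rewrite ?(subsetP sMG).
have mx2 (K L : {group hT}) : K \subset L -> ~~ (L \subset K) -> L \subset G ->
    #|G : K| = 2 -> L :=: G.
  move=> sKL sLK sLG iKG; have sKG := subset_trans sKL sLG.
  have mxK : maximal K G by apply: p_index_maximal; rewrite ?iKG.
  have [_ mx] := maxgroupP mxK; apply/eqP; rewrite eqEproper sLG /=.
  by apply: contra sLK => prL; rewrite (mx _ prL sKL).
have MK (K : {group hT}) : ~~ (K \subset M) -> K \subset G -> M * K = G.
  move=> sKM sKG; rewrite -norm_joinEr ?(subset_trans sKG) //.
  apply: (mx2 M) => //; rewrite ?joing_subl // ?join_subG ?sMG //.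
  by rewrite negb_and sKM orbT.
(* Here [M * K = G], and [M :&: K] contains [<[m ^+ 2]>], of index at most 2 in [M]; so [K] has
   index at most 2 in [G]. *)
have iK (K : {group hT}) : ~~ (K \subset M) -> K \subset G -> m ^+ 2 \in K ->
    #|G| <= #|K| * 2.
  move=> sKM sKG Km2; have := mul_cardG M K; rewrite MK // => e.
  rewrite -(leq_pmul2r (cardG_gt0 (M :&: K))) -e mulnC -mulnA leq_mul //.
  rewrite {1}defM -orderE (leq_trans (leq_order_sqr m)) // mulnC leq_mul //.
  by rewrite subset_leq_card // cycle_subG inE Km2 groupX.
have [sOM|sOM] := boolP ('Ohm_1(G) \subset M).
  (* All involutions lie in the cyclic [M], so there is only one, and [G] is cyclic or
     quaternion. *)
  right; have : #|'Ohm_1(G)| = 2.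
    rewrite -(Ohm1_cyclic_pgroup_prime cM pM ntM); congr #|pred_of_set _|.
    by apply/eqP; rewrite eqEsubset (OhmS 1 sMG) andbT -Ohm_id OhmS.
  move/(prime_Ohm1P pG ntG); rewrite (negPf ncG) /= => /eqP/quaternion_classP.
  by case=> w w_gt2 isoG; exists w.
have [oOG|neOG] := eqVneq 'Ohm_1(G) G; last first.
  (* ['Phi(G)] supplies [m ^+ 2] without making [K] the whole group, so the characteristic subgroup
     [K] has index 2 and is cyclic. Its only involution lies in [M :&: K], which would force
     ['Ohm_1(G)] into [M]. *)
  pose K := ('Phi(G) <*> 'Ohm_1(G))%G.
  have chK : K \char G by rewrite charY ?Phi_char ?Ohm_char.
  have sKG := char_sub chK.
  have prK : K \proper G.
    rewrite properEneq sKG andbT; apply: contraNneq neOG => /Phi_nongen.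
    by rewrite genGid => ->.
  have iKG : #|G : K| = 2.
    have leK : #|G : K| <= 2.
      rewrite -(leq_pmul2l (cardG_gt0 K)) Lagrange //; apply: iK => //.
        by apply: contra sOM; apply: subset_trans; apply: joing_subr.
      by rewrite mem_gen // inE Pm2.
    by apply/eqP; rewrite eqn_leq leK indexg_gt1 proper_subn.
  have cK := affine_cycle_2_maximal_cyclic pG Xu erefl (char_normal chK)
               (Aut_char_closed Aa chK) iKG.
  case/negP: sOM; rewrite -Ohm_id.
  have ntO : 'Ohm_1(G) != 1 by rewrite -(Ohm1_eq1 G) in ntG.
  have sOK : 'Ohm_1('Ohm_1(G)) \subset 'Ohm_1(K) by rewrite OhmS ?joing_subr.
  apply: subset_trans sOK _.
  have ntMK : (M :&: K)%G :!=: 1.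
    apply: contraNneq ntM => tiMK; rewrite -Ohm1_eq1 -subG1 -tiMK subsetI Ohm_sub.
    by rewrite (subset_trans (OhmS 1 sMG)) ?joing_subr.
  apply: subset_trans (subsetIl M K).
  apply: Ohm1_cycle_sub => //; first exact: pgroupS pG.
  exact: subsetIr.
left; exists v.+2; rewrite // -oG.
have inv (K : {group hT}) : ~~ (G \subset K) ->
    exists2 t, t \in G :\: K & #[t] = 2.
  move=> sGK; have : ~~ ('Ldiv_2(G) \subset K).
    by apply: contra sGK; rewrite -{2}oOG (OhmE 1 pG) gen_subG.
  case/subsetPn=> t /LdivP[Gt t2] Kt; exists t; first by rewrite inE Kt.
  apply: nt_prime_order => //; by apply: contraNneq Kt => ->; apply: group1.
(* An involution [t] outside [M] makes [N] of index 2, and proper because [G] is not cyclic. An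
   involution [w] outside [N] then generates [G] together with [t], first modulo ['Phi(G)] and hence
   outright. *)
have [t /setDP[Gt Mt] ot] : exists2 t, t \in G :\: M & #[t] = 2.
  by apply: inv; rewrite -indexg_gt1 iM.
pose N := ('Phi(G) <*> <[t]>)%G.
have sNG : N \subset G by rewrite join_subG Phi_sub cycle_subG.
have prN : ~~ (G \subset N).
  apply/negP=> sGN; have/Phi_nongen : 'Phi(G) <*> <[t]> = G.
    by apply/eqP; rewrite eqEsubset sNG.
  by rewrite genGid => defG; rewrite -defG cycle_cyclic in ncG.
have [w /setDP[Gw Nw] ow] := inv N prN.
have mN : m ^+ 2 \in N by rewrite mem_gen // inE Pm2.
have iN : #|G : N| = 2.
  apply/eqP; rewrite eqn_leq indexg_gt1 prN andbT.
  rewrite -(leq_pmul2l (cardG_gt0 N)) Lagrange //; apply: iK => //.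
  by apply: contra Mt => /subsetP; apply; rewrite mem_gen // inE cycle_id orbT.
have defG : <<[set t; w]>> = G.
  apply: Phi_nongen; apply: (mx2 N) => //.
  - by rewrite join_subG joing_subl cycle_subG mem_gen // !inE eqxx orbT.
  - by apply: contra Nw => /subsetP; apply; rewrite mem_gen // !inE eqxx !orbT.
  by rewrite join_subG Phi_sub subUset !sub1set Gt Gw.
have ntw : t != w.
  by apply: contraNneq Nw => <-; rewrite mem_gen // inE cycle_id orbT.
by have := involutions_gen_dihedral ot ow ntw; rewrite defG.
Qed.

(** * Dihedral and quaternion groups *)

Section InversionExtension.

Variables (hT : finGroupType) (G : {group hT}) (r : nat).

Definition inversion_pair (m g : hT) : Prop :=
  [/\ m \in G, g \in G, #|G| = (2 * #[m])%N & g \notin <[m]>].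

(** With [r = 0] these are the dihedral relations, the Klein four-group included; with [r] half the
    order of [m], the quaternion ones. *)
Definition inversion_rels (m g : hT) : Prop := m ^ g = m^-1 /\ g ^+ 2 = m ^+ r.

Lemma inversion_pair_cases m g x : inversion_pair m g -> x \in G ->
  exists i, x = m ^+ i \/ x = m ^+ i * g.
Proof.
case=> Gm Gg oG mg Gx; have smG : <[m]> \subset G by rewrite cycle_subG.
have [/cycleP[i ->]|mx] := boolP (x \in <[m]>); first by exists i; left.
have i2 : #|G : <[m]>| = 2 by rewrite -divgS // oG -orderE mulnK.
have := rcoset_index2 smG i2; move/(_ g); rewrite inE mg Gg => /(_ isT)/setP/(_ x).
rewrite !inE mx Gx => /rcosetP[_ /cycleP[i ->] ->].
by exists i; right.
Qed.

Lemma inversion_conjX (m g : hT) i : m ^ g = m^-1 -> g * m ^+ i = m ^- i * g.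
Proof.
move=> mg; rewrite conjgCV conjXg.
by rewrite -[m in m ^ g^-1]invgK -mg -conjVg conjgK -expgVn.
Qed.

(** The relations determine all products of the normal forms [m ^+ i] and [m ^+ i * g], so keeping
    the normal form while changing the pair is an automorphism. *)
Lemma Aut_inversion_exists m0 g0 m g :
    inversion_pair m0 g0 -> inversion_rels m0 g0 ->
    inversion_pair m g -> inversion_rels m g ->
  exists2 a, a \in Aut G & a m0 = m /\ a g0 = g.
Proof.
move=> Y0 [inv0 sqr0] Y1 [inv1 sqr1].
have [Gm0 Gg0 oG mg0] := Y0; have [Gm Gg oG1 mg] := Y1.
have om : #[m] = #[m0].
  by apply/eqP; rewrite -(eqn_pmul2l (isT : 0 < 2)) -oG1 oG.
have dv : #[m] %| #[m0] by rewrite om.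
pose z := eltm dv.
have zE i : z (m0 ^+ i) = m ^+ i by apply: eltmE.
pose f x := if x \in <[m0]> then z x else z (x * g0^-1) * g.
have f1 i : f (m0 ^+ i) = m ^+ i by rewrite /f mem_cycle zE.
have f2 i : f (m0 ^+ i * g0) = m ^+ i * g.
  by rewrite /f groupMl ?mem_cycle // (negPf mg0) mulgK zE.
have V0 (n : hT) j : n ^- j = n ^+ (j * #[n].-1).
  apply/eqP; rewrite eq_invg_mul -expgD -mulnS prednK // mulnC expgM.
  by rewrite expg_order expg1n.
have fM : {in G &, {morph f : x y / x * y}}.
  move=> x y Gx Gy; have [i [->|->]] := inversion_pair_cases Y0 Gx;
    have [j [->|->]] := inversion_pair_cases Y0 Gy.
  - by rewrite -expgD !f1 expgD.
  - by rewrite mulgA -expgD !f2 f1 expgD mulgA.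
  - rewrite -mulgA (inversion_conjX j inv0) mulgA V0 -expgD !f2 f1.
    by rewrite -mulgA (inversion_conjX j inv1) mulgA V0 om expgD.
  rewrite !mulgA -[m0 ^+ i * g0 * _]mulgA (inversion_conjX j inv0) -!mulgA.
  rewrite -[g0 * g0]/(g0 ^+ 2) sqr0 V0 -!expgD f1 !f2 -!mulgA.
  rewrite [g * (_ * g)]mulgA (inversion_conjX j inv1) -!mulgA.
  by rewrite -[g * g]/(g ^+ 2) sqr1 V0 om -!expgD.
pose F := Morphism fM.
have injF : 'injm F.
  apply/subsetP=> x /morphpreP[Gx]; rewrite !inE /=.
  have [i [->|->]] := inversion_pair_cases Y0 Gx.
    by rewrite f1 -!order_dvdn om.
  rewrite f2 => /eqP e; case/negP: mg.
  by rewrite -(groupMl _ (mem_cycle m i)) e group1.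
have imF : F @* G = G.
  apply/eqP; rewrite eqEcard card_injm // leqnn andbT.
  apply/subsetP=> _ /morphimP[x _ Gx ->] /=.
  have [i [->|->]] := inversion_pair_cases Y0 Gx; rewrite ?f1 ?f2.
    exact: groupX.
  by rewrite groupM ?groupX.
exists (aut injF imF); first exact: Aut_aut.
rewrite !autE //=.
by split; [have := f1 1%N | have := f2 0%N]; rewrite ?expg1 ?expg0 ?mul1g.
Qed.

Lemma Aut_inversion_inj m g a b : inversion_pair m g ->
  a \in Aut G -> b \in Aut G -> a m = b m -> a g = b g -> a = b.
Proof.
move=> Y Aa Ab em eg; have [Gm Gg _ _] := Y.
apply: (eq_Aut Aa Ab) => x Gx.
have [i [->|->]] := inversion_pair_cases Y Gx.
  by rewrite (AutX _ Aa) // (AutX _ Ab) // em.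
rewrite (AutM Aa) ?groupX // (AutM Ab) ?groupX //.
by rewrite (AutX _ Aa) // (AutX _ Ab) // em eg.
Qed.

End InversionExtension.

Section InversionCount.

Variables (hT : finGroupType) (G : {group hT}) (r e : nat).
Hypothesis r_even : ~~ odd r.
Hypothesis oG : #|G| = (2 ^ e.+2)%N.
Hypothesis rels : forall m g, inversion_pair G m g -> inversion_rels r m g.

Let q := (2 ^ e.+1)%N.
Let pG : 2.-group G. Proof. by rewrite /pgroup oG pnatX. Qed.

Let pairP m g : inversion_pair G m g <->
  [/\ m \in G, g \in G, #[m] = q & g \notin <[m]>].
Proof.
split=> -[Gm Gg om mg]; split=> //; last by rewrite om oG expnS.
by apply/eqP; rewrite eq_sym -(eqn_pmul2l (isT : 0 < 2)) -om oG expnS.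
Qed.

Let coprime_q k : coprime k q = odd k.
Proof. by rewrite coprime_pexpr // coprime_sym coprime2n. Qed.

Let sqr_odd_mod4 k : odd k -> k ^ 2 == 1 %[mod 4].
Proof.
move=> k_odd; rewrite -(odd_double_half k) k_odd -mul2n.
have -> : ((1 + 2 * k./2) ^ 2 = (k./2 + k./2 ^ 2) * 4 + 1)%N by ring.
by rewrite modnMDl.
Qed.

(** With [a m = m ^+ k], two steps act on the exponents of [m] as [y |-> k ^ 2 y + b]. Both [k] and
    [b] are odd, so the Hull-Dobell criterion holds and even times cover [<[m]>]; odd times then
    cover the other coset. *)
Lemma inversion_affine_cycle m g a : inversion_pair G m g -> a \in Aut G ->
  a g = g * m -> a m \in <[m]> -> (g, a) \in affine_cycles G.
Proof.
move=> Y Aa eag mam; have [inv sqr] := rels Y.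
have [Gm Gg om mg] := (pairP m g).1 Y.
have defam : <[a m]> = <[m]>.
  apply/eqP; rewrite eqEcard cycle_subG mam /= -!orderE.
  by rewrite -(autmE Aa) order_injm ?injm_autm.
have [k k_gt0 ek] : exists2 k, 0 < k & a m = m ^+ k.
  case/cycleP: mam => k ->; exists (k + #[m])%N.
    by rewrite addn_gt0 order_gt0 orbT.
  by rewrite expgD expg_order mulg1.
have k_odd : odd k.
  by rewrite -coprime_q -om coprime_sym -generator_coprime -ek /generator defam.
(* [g * m * g = m ^+ r * m^-1], with the inverse written as [m ^+ q.-1]; parity of [r] makes [b]
   odd. *)
pose b := (r + q.-1)%N.
have q_gt0 : 0 < q by rewrite expn_gt0.
have b_odd : odd b.
  by rewrite oddD (negPf r_even) /= -[odd _]negbK -oddS prednK // oddX.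
have m1 : m ^+ q.-1 = m^-1.
  by apply/esym/eqP; rewrite eq_invg_mul -expgS prednK // -om expg_order.
have gg i : g * m ^+ i * g = m ^+ r * m ^- i.
  rewrite (inversion_conjX i inv) -mulgA -[g * g]/(g ^+ 2) sqr.
  by apply/commute_sym/commuteV/commuteX2.
have aX n : a (m ^+ n) = m ^+ (k * n) by rewrite (AutX _ Aa) // ek -expgM.
have gmg : g * (m * g) = m ^+ b by have := gg 1%N; rewrite expg1 -m1 -expgD mulgA.
have iter2 j : iter (j * 2) (affine (g, a)) 1 = m ^+ (b * geom (k ^ 2) j).
  elim: j => [|j IHj]; first by rewrite geom0 muln0.
  rewrite mulSn iterD IHj /= /affine /= aX (AutM Aa) ?groupX // aX eag.
  rewrite -!mulgA gmg -expgD; congr (_ ^+ _).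
  by rewrite geomS; ring.
have hdk : hd_modulus q %| (k ^ 2).-1.
  rewrite hd_modulus_dvd; apply/allP=> p; rewrite primesX // primes_prime //.
  rewrite inE => /eqP->; apply: (@dvdn_trans 4); first by rewrite /hd_exp; case: ifP.
  by rewrite -modn1_predn ?expn_gt0 ?k_gt0 // sqr_odd_mod4.
have tr y : exists j, m ^+ y = iter (j * 2) (affine (g, a)) 1.
  have k2 : 0 < k ^ 2 by rewrite expn_gt0 k_gt0.
  have cob : coprime b q by rewrite coprime_q.
  have [j ej] := lcg_full q_gt0 k2 cob hdk y; exists j.
  by rewrite iter2; apply/eqP; rewrite eq_sym eq_expg_mod_order om ej.
apply/affine_cyclesP; split=> // x Gx.
have [i [->|->]] := inversion_pair_cases Y Gx.
  by have [j ->] := tr i; exists (j * 2)%N.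
have /cycleP[l el] : m ^+ i \in <[a m]> by rewrite defam mem_cycle.
have [j ej] := tr l; exists (j * 2).+1.
by rewrite iterS -ej /affine /= (AutX _ Aa) // -el.
Qed.

(** An invariant cyclic maximal [M] cannot contain [u.1], or the orbit of [1] would stay in it.
    Hence [u.1] and its image lie in the same coset of [M], and it remains to see that their
    quotient [m] generates [M]. *)
Lemma affine_cycle_inversion u : u \in affine_cycles G ->
  let m := u.1^-1 * u.2 u.1 in
  inversion_pair G m u.1 /\ u.2 m \in <[m]>.
Proof.
case: u => g a Xu m; have /affine_cyclesP[/= Gg Aa tr] := Xu.
have G_gt1 : 1 < #|G| by rewrite oG (ltn_exp2l 0).
have [M [nsMG /= aM iM]] := affine_cycle_exists_maximal pG Xu erefl G_gt1.
have cM := affine_cycle_2_maximal_cyclic pG Xu erefl nsMG aM iM.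
have [sMG nMG] := andP nsMG.
have [m1 defM] := cyclicP cM; have Mm1 : m1 \in M by rewrite defM cycle_id.
have Mg : g \notin M.
  apply/negP=> Mg; have sGM : G \subset M.
    apply/subsetP=> x /tr[k ->]; elim: k => [|k IHk]; first exact: group1.
    by rewrite iterS /affine /= groupM ?aM.
  have : 1 < #|G : M| by rewrite iM.
  by rewrite indexg_gt1 sGM.
have om1 : #[m1] = q.
  apply/eqP; rewrite orderE -defM -(eqn_pmul2r (isT : 0 < 2)) -{1}iM Lagrange //.
  by rewrite oG -expnSr.
have Y1 : inversion_pair G m1 g.
  by apply/pairP; rewrite -defM (subsetP sMG).
have [inv1 sqr1] := rels Y1.
have Mag : a g \notin M.
  have aME : a @: M = M.
    apply/eqP; rewrite eqEcard (card_imset _ perm_inj) leqnn andbT.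
    by apply/subsetP=> _ /imsetP[x Mx ->]; apply: aM.
  by rewrite -aME (mem_imset _ _ perm_inj).
have Mm : m \in M.
  have gD : g \in G :\: M by rewrite inE Mg.
  have : a g \in M :* g by rewrite (rcoset_index2 sMG iM gD) inE Mag Aut_closed.
  case/rcosetP=> y My eag; rewrite /m /= eag -conjgE memJ_norm //.
  exact: (subsetP nMG).
have gm : a g = g * m by rewrite /m mulKVg.
have oddm : <[m]> = M.
  have /cycleP[i ei] : m \in <[m1]> by rewrite -defM.
  have [i_odd|i_even] := boolP (odd i).
    apply/esym/eqP; rewrite defM -[_ == _]/(generator <[m1]> m) ei.
    by rewrite generator_coprime coprime_sym om1 coprime_q.
  (* If [m] were in [N], the union of [N] and [g N] would be preserved by the affine map, and the
     orbit of [1] would miss [m1]. *)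
  pose N := <[m1 ^+ 2]>; have sNM : N \subset M by rewrite defM cycleX.
  have Neven j : ~~ odd j -> m1 ^+ j \in N.
    move=> j_even.
    by rewrite -(odd_double_half j) (negPf j_even) -mul2n expgM mem_cycle.
  have aN x : x \in N -> a x \in N.
    case/cycleP=> j ->; have /cycleP[c ec] : a m1 \in <[m1]> by rewrite -defM aM.
    rewrite -expgM (AutX _ Aa) ?(subsetP sMG) // ec -expgM Neven //.
    by rewrite !oddM andbF.
  have NJ x : x \in N -> x ^ g \in N.
    by case/cycleP=> j ->; rewrite !conjXg inv1 expgVn groupX // groupV cycle_id.
  have Siter k :
      iter k (affine (g, a)) 1 \in N \/ g^-1 * iter k (affine (g, a)) 1 \in N.
    elim: k => [|k]; first by left; apply: group1.
    rewrite iterS; set x := iter k _ 1; rewrite /affine /= => -[Nx|Nx].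
      by right; rewrite -conjgE NJ ?aN.
    left; set y := g^-1 * x in Nx; have -> : x = g * y by rewrite mulKVg.
    have Gy : y \in G by rewrite (subsetP sMG) ?(subsetP sNM).
    rewrite (AutM Aa) // gm.
    have -> : g * m * a y * g = g ^+ 2 * (m * a y) ^ g.
      by rewrite -[g * m * _]mulgA -mulgA (conjgC (m * a y)) mulgA.
    by rewrite groupM ?sqr1 ?Neven // NJ // groupM ?aN // ei Neven.
  have [k ek] := tr m1 (subsetP sMG _ Mm1); have := Siter k; rewrite -ek.
  case=> [Nm1|/(subsetP sNM)]; last by rewrite groupMr // groupV (negPf Mg).
  have : generator <[m1]> (m1 ^+ 2).
    by rewrite /generator eqEsubset cycleX cycle_subG Nm1.
  by rewrite generator_coprime om1 coprime_sym coprime_q.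
split; last by rewrite oddm aM.
have om : #[m] = q by rewrite orderE oddm defM -orderE.
by apply/pairP; split=> //; rewrite ?oddm ?(subsetP sMG).
Qed.

(* Every orbit of [Aut G] on affine cycles has a unique member [(g0, a)] with
   [a g0 = g0 * m0], and such [a] are classified by the generator [a m0]. *)
Lemma card_affine_cycles_inversion m0 g0 : inversion_pair G m0 g0 ->
  #|affine_cycles G| = (2 ^ e * #|Aut G|)%N.
Proof.
move=> Y0; have rel0 := rels Y0; have [Gm0 Gg0 om0 mg0] := (pairP m0 g0).1 Y0.
pose K := [set a in Aut G | (a g0 == g0 * m0) && (a m0 \in <[m0]>)].
have oK : #|K| = (2 ^ e)%N.
  have -> : (2 ^ e)%N = totient #[m0] by rewrite om0 totient_pfactor // mul1n.
  rewrite totient_gen -(@card_in_imset _ _ (fun a : {perm hT} => a m0)); last first.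
    move=> a b /setIdP[Aa /andP[/eqP ag _]] /setIdP[Ab /andP[/eqP bg _]] /= em.
    by apply: (Aut_inversion_inj Y0 Aa Ab em); rewrite ag.
  congr #|pred_of_set _|; apply/setP=> y; rewrite inE.
  apply/imsetP/idP=> [[a /setIdP[Aa /andP[_ am]] ->]|gen_y].
    rewrite /generator eq_sym eqEcard cycle_subG am /= -!orderE.
    by rewrite -(autmE Aa) order_injm ?injm_autm.
  have defy : <[m0]> = <[y]> by apply/eqP.
  have Yy : inversion_pair G y (g0 * m0).
    apply/pairP; split; first by rewrite -cycle_subG -defy cycle_subG.
    - exact: groupM.
    - by rewrite orderE -defy -orderE.
    by rewrite -defy groupMr ?cycle_id.
  have [a Aa [am ag]] := Aut_inversion_exists Y0 rel0 Yy (rels Yy).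
  exists a; last by rewrite am.
  by apply/setIdP; rewrite ag am eqxx defy cycle_id.
rewrite -oK mulnC -cardsX.
pose F (ta : {perm hT} * {perm hT}) := (ta.1 g0, ta.2 ^ ta.1).
rewrite -(@card_in_imset _ _ F); last first.
  move=> [t a] [t' a'] /setXP[/= At /setIdP[Aa /andP[/eqP ag _]]].
  case/setXP=> /= At' /setIdP[Aa' /andP[/eqP ag' _]] [/= eg ea].
  (* The pair [(t g0, a ^ t)] determines [t (a g0) = t g0 * t m0], hence [t m0] and with it [t]. *)
  have em : t m0 = t' m0.
    have := perm_conj t a g0; rewrite ea eg perm_conj ag ag'.
    by rewrite (AutM At) // (AutM At') // eg => /mulgI.
  have ett : t = t' by apply: (Aut_inversion_inj Y0 At At' em eg).
  by move: ea; rewrite ett => /conjg_inj ->.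
congr #|pred_of_set _|; apply/setP=> -[g b]; apply/idP/imsetP=> [Xu|[[t a]]].
  have [/= Y bm] := affine_cycle_inversion Xu; have /affine_cyclesP[/= Gg Ab _] := Xu.
  set m := g^-1 * b g in Y bm.
  have [t At [tm tg]] := Aut_inversion_exists Y0 rel0 Y (rels Y).
  have Gm : m \in G by case: Y.
  exists (t, b ^ t^-1); last by rewrite /F /= tg conjgKV.
  rewrite in_setX At; apply/setIdP; split; first by rewrite groupJ ?groupV.
  have Vt x y : t x = y -> t^-1 y = x by move<-; rewrite permK.
  rewrite -{1}(Vt _ _ tg) -{2}(Vt _ _ tm) !perm_conj.
  have -> : b g = g * m by rewrite mulKVg.
  rewrite (AutM (groupVr At)) // (Vt _ _ tm) (Vt _ _ tg) eqxx /=.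
  case/cycleP: bm => i ->; rewrite (AutX _ (groupVr At)) // (Vt _ _ tm).
  exact: mem_cycle.
case/setXP=> /= At /setIdP[Aa /andP[/eqP ag am]] ->.
apply: (@affine_cycles_conj _ G t (g0, a) At).
exact: inversion_affine_cycle Y0 Aa ag am.
Qed.

End InversionCount.

Lemma extremal_inversion_pair (hT : finGroupType) (G : {group hT}) e m g :
    #|G| = (2 ^ e.+2)%N ->
  inversion_pair G m g <-> extremal_generators G 2 e.+2 (m, g).
Proof.
move=> oG; split=> [[Gm Gg om mg]|[_ Gm om /setDP[Gg mg]]].
  split=> //; last by rewrite inE mg.
  by apply/eqP; rewrite -(eqn_pmul2l (isT : 0 < 2)) -om oG expnS.
by split=> //; rewrite oG om expnS.
Qed.

Lemma card_affine_cycles_dihedral (hT : finGroupType) (G : {group hT}) v :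
  v > 1 -> G \isog 'D_(2 ^ v) -> #|affine_cycles G| = (2 ^ v.-2 * #|Aut G|)%N.
Proof.
case: v => [|[|e]] // v_gt1 isoG.
have oG : #|G| = (2 ^ e.+2)%N by rewrite (card_isog isoG) card_2dihedral.
have [[m g] gen _] := generators_2dihedral v_gt1 isoG.
have Y := (extremal_inversion_pair m g oG).2 gen.
apply: (@card_affine_cycles_inversion _ _ 0 _ isT oG _ _ _ Y).
move=> x y /(extremal_inversion_pair x y oG).1 gen'.
have [_ Gx _ Gy] := gen'.
have [[_ o2 inv] _ _ _ _] := dihedral2_structure v_gt1 gen' isoG.
split; first by rewrite inv ?cycle_id.
by rewrite expg0 -(o2 y Gy) expg_order.
Qed.

Lemma card_affine_cycles_quaternion (hT : finGroupType) (G : {group hT}) v :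
  v > 2 -> G \isog 'Q_(2 ^ v) -> #|affine_cycles G| = (2 ^ v.-2 * #|Aut G|)%N.
Proof.
case: v => [|[|[|e]]] // v_gt2 isoG.
have oG : #|G| = (2 ^ e.+3)%N by rewrite (card_isog isoG) card_quaternion.
have [[m g] gen _] := generators_quaternion v_gt2 isoG.
have Y := (extremal_inversion_pair m g oG).2 gen.
(* [2 ^ e.+1] is half of [#[m]]: the corresponding power of [m] is the unique involution, hence the
   square of every element outside [<[m]>]. *)
apply: (@card_affine_cycles_inversion _ _ (2 ^ e.+1) _ _ oG _ _ _ Y).
  by rewrite oddX.
move=> x y /(extremal_inversion_pair x y oG).1 gen'.
have [_ Gx _ Gy] := gen'.
have [[_ o4 inv] _ [_ _ uniq2 _ _] _ _] := quaternion_structure v_gt2 gen' isoG.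
have Gy' : y \in G by case/setDP: Gy.
split; first by rewrite inv ?cycle_id.
by apply: uniq2; rewrite ?groupX // orderXdiv o4.
Qed.

(** * Nilpotent groups *)

Lemma cyclic_Zp n : cyclic (Zp n).
Proof.
by rewrite /Zp; case: ifP => _; [rewrite Zp_cycle cycle_cyclic | rewrite cyclic1].
Qed.

Lemma dprod_isog_setX (gT kT lT : finGroupType) (G A B : {group gT})
    (K : {group kT}) (L : {group lT}) :
  A \x B = G -> A \isog K -> B \isog L -> G \isog setX K L.
Proof.
move=> defG isoA isoB; apply: (isog_dprod defG (setX_dprod K L)).
  exact: isog_trans isoA (isog_setX1 _ K).
exact: isog_trans isoB (isog_set1X _ L).
Qed.

Lemma cyclic_isog_Zp (gT : finGroupType) (G : {group gT}) :
  cyclic G -> G \isog Zp #|G|.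
Proof. by move=> cG; rewrite isog_cyclic_card //= cyclic_Zp card_Zp /=. Qed.

Section Nilpotent.

Variables (gT : finGroupType) (G : {group gT}).
Hypotheses (nilG : nilpotent G) (XG : 0 < #|affine_cycles G|).

(** The number of cycles is a product over coprime direct factors, so it is nonzero on each
    factor. *)
Let pcoreX pi : 0 < #|affine_cycles 'O_pi(G)|.
Proof.
have defG := nilpotent_pcoreC pi nilG.
have co := coprime_pcoreC pi G G.
move: XG; rewrite (card_affine_cycles_coprime_dprod defG co).
by rewrite muln_gt0 => /andP[].
Qed.

Lemma affine_cycle_nil_odd_cyclic : cyclic 'O_2^'(G).
Proof.
apply: nil_Zgroup_cyclic; last exact: nilpotentS (pcore_sub _ _) nilG.
apply/forall_inP=> V /andP[/p_groupP[p pr_p pV] /andP[sVO _]].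
have sVG := subset_trans sVO (pcore_sub _ _).
have [p2|odd_p] := even_prime pr_p.
  suff -> : V :=: 1 by apply: cyclic1.
  have p'V : 2^'.-group V by apply: pgroupS sVO (pcore_pgroup _ _).
  apply/eqP; rewrite trivg_card1; apply/eqP.
  by apply: (@pnat_1 2); rewrite -?p2 // ?p2.
have /card_gt0P[u Xu] := pcoreX p.
have cyc := affine_cycle_odd_cyclic (pcore_pgroup p G) Xu pr_p odd_p.
apply: cyclicS cyc; rewrite (sub_normal_Hall (nilpotent_pcore_Hall p nilG)) //.
exact: pcore_normal.
Qed.

Lemma affine_cycle_nil_structure : cyclic G \/
  exists v n', [/\ odd n', #|G| = (2 ^ v * n')%N
    & (v > 1 /\ G \isog setX 'D_(2 ^ v) (Zp n')) \/
      (v > 2 /\ G \isog setX 'Q_(2 ^ v) (Zp n'))].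
Proof.
have defG := nilpotent_pcoreC 2 nilG; have co := coprime_pcoreC 2 G G.
have c2' := affine_cycle_nil_odd_cyclic.
have [c2|nc2] := boolP (cyclic 'O_2(G)).
  by left; rewrite (cyclic_dprod defG).
right; have /card_gt0P[u Xu] := pcoreX 2.
have oG := dprod_card defG.
have odd' : odd #|'O_2^'(G)|.
  by rewrite -[odd _]negbK -dvdn2 -p'natE // [_.-nat _]pcore_pgroup.
have iso' := cyclic_isog_Zp c2'.
have [[v v_gt iso2]|[v v_gt iso2]] :=
    affine_cycle_2group_structure (pcore_pgroup 2 G) Xu nc2.
- exists v, #|'O_2^'(G)|; split=> //; last first.
    by left; split=> //; apply: dprod_isog_setX defG iso2 iso'.
  by rewrite -oG (card_isog iso2) card_2dihedral.
exists v, #|'O_2^'(G)|; split=> //; last first.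
  by right; split=> //; apply: dprod_isog_setX defG iso2 iso'.
by rewrite -oG (card_isog iso2) card_quaternion.
Qed.

End Nilpotent.

(** * The Hopf-Galois number as an isomorphism invariant *)

Section Count.

Implicit Types gT hT kT : finGroupType.

(** For [n = #|G|] this is e(C_n, G) computed inside [G], and it is 0 for a group without affine
    cycles. *)
Definition affine_index hT (G : {group hT}) : nat :=
  #|affine_cycles G| %/ #|Aut G|.

Lemma affine_indexE hT (G : {group hT}) c :
  #|affine_cycles G| = (c * #|Aut G|)%N -> affine_index G = c.
Proof. by rewrite /affine_index => ->; rewrite mulnK // cardG_gt0. Qed.

Lemma affine_index_isog hT kT (G : {group hT}) (K : {group kT}) :
  G \isog K -> affine_index G = affine_index K.
Proof.
by move=> iso; rewrite /affine_index (card_affine_cycles_isog iso) (card_Aut_isog iso).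
Qed.

Lemma e_HG_affine_index gT hT : cyclic [set: gT] -> #|gT| = #|hT| ->
  e_HG gT hT = affine_index [set: hT].
Proof.
by move=> cG o; apply/esym/affine_indexE; rewrite e_HG_mul_Aut.
Qed.

Lemma e_HG_subg gT hT (G : {group hT}) : cyclic [set: gT] -> #|gT| = #|G| ->
  e_HG gT (subg_of G) = affine_index G.
Proof.
move=> cG o; rewrite e_HG_affine_index ?(affine_index_isog (isog_subg G)) //.
by rewrite card_sub o; apply: eq_card.
Qed.

Lemma affine_index_cyclic hT (G : {group hT}) : cyclic G ->
  affine_index G = #|G| %/ hd_modulus #|G|.
Proof. by move=> cG; apply/affine_indexE/card_affine_cycles_cyclic. Qed.

Lemma hd_modulus_odd n : odd n -> hd_modulus n = radical n.
Proof.
move=> n_odd; rewrite hd_modulusE ?odd_gt0 // ifN //.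
apply/negP=> n4; have : 2 %| n by apply: dvdn_trans n4.
by rewrite dvdn2 n_odd.
Qed.

Lemma affine_index_setX hT (P : {group hT}) n c : odd n -> 2.-group P ->
    #|affine_cycles P| = (c * #|Aut P|)%N ->
  affine_index (setX P (Zp n))%G = (c * (n %/ radical n))%N.
Proof.
move=> n_odd pP cP.
have n_gt0 := odd_gt0 n_odd.
have oZ : #|Zp n| = n by apply: card_Zp.
have iso1 := isog_setX1 'Z_n P.
have iso2 := isog_set1X hT (Zp n)%G.
have o1 := card_isog iso1; have o2 := card_isog iso2.
have co : coprime #|setX P [1 'Z_n]| #|setX [1 hT] (Zp n)|.
  rewrite -[#|setX P _|]o1 -[#|setX _ (Zp n)|]o2 /= oZ.
  have /p_natP[k ->] := pP; case: k => [|k]; first by rewrite coprime1n.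
  by rewrite coprime_pexpl // coprime2n.
have defX := setX_dprod P (Zp n)%G.
apply: affine_indexE.
pose C := setX_group 1%G (Zp n)%G : {group hT * 'Z_n}.
rewrite (card_affine_cycles_coprime_dprod (H := (setX P 1)%G) (K := C) defX co).
rewrite (card_Aut_coprime_dprod (H := (setX P 1)%G) (K := C) defX co).
rewrite -(card_affine_cycles_isog iso1) -(card_affine_cycles_isog iso2).
rewrite -(card_Aut_isog iso1) -(card_Aut_isog iso2) cP.
rewrite (card_affine_cycles_cyclic (cyclic_Zp n)) /= oZ hd_modulus_odd //.
by rewrite mulnACA.
Qed.

Lemma Cayley_ordinal hT n : #|hT| = n ->
  exists H : {group {perm 'I_n}}, [set: hT] \isog H.
Proof.
move=> <-.
have inj (x : hT) : injective (fun i : 'I_#|hT| => enum_rank (enum_val i * x)).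
  by move=> i j /enum_rank_inj/mulIg/enum_val_inj.
pose f x : {perm 'I_#|hT|} := perm (inj x).
have fM : {in [set: hT] &, {morph f : x y / x * y}}.
  by move=> x y _ _; apply/permP=> i; rewrite permM !permE enum_rankK mulgA.
pose F := Morphism fM.
exists (F @* [set: hT])%G; apply/isogP; exists F => //.
apply/injmP=> x y _ _ /(congr1 (fun s : {perm 'I_#|hT|} => s (enum_rank (1 : hT)))).
by rewrite !permE !enum_rankK !mul1g => /enum_rank_inj.
Qed.

End Count.

(** * Sums over isomorphism classes *)

(** Groups without affine cycles have index 0, so [s] only has to represent the classes that carry
    one. *)
Lemma e_sum_reps (gT : finGroupType) (P : forall n, {group {perm 'I_n}} -> bool)
    (s : seq {group {perm 'I_#|gT|}}) :
    cyclic [set: gT] -> uniq s ->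
    {in s, forall H : {group {perm 'I_#|gT|}}, #|H| = #|gT| /\ P _ H} ->
    {in s &, forall H K : {group {perm 'I_#|gT|}}, H \isog K -> H = K} ->
    (forall H : {group {perm 'I_#|gT|}}, #|H| = #|gT| -> P _ H ->
       0 < #|affine_cycles H| -> exists2 K, K \in s & H \isog K) ->
  e_sum gT P = \sum_(H <- s) affine_index H.
Proof.
move=> cG Us sP s_inj s_cov; rewrite /e_sum /iso_classes /equivalence_partition.
set D := groups_of_order _.
pose cl (H : {group {perm 'I_#|gT|}}) := [set K in D | H \isog K].
have DP (H : {group {perm 'I_#|gT|}}) : reflect (#|H| = #|gT| /\ P _ H) (H \in D).
  rewrite inE in_setT /=; by apply: (iffP andP) => -[/eqP].
have clE H : H \in D ->
    e_HG gT (subg_of (odflt 1%G [pick K in cl H])) = affine_index H.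
  (* The class contains [H], so the default [1%G] never occurs, and the representative picked is
     immaterial by isomorphism invariance. *)
  move=> DH; case: pickP => [K|/(_ H)]; last by rewrite inE DH isog_refl.
  rewrite inE => /andP[/DP[oK _] isoHK] /=.
  by rewrite e_HG_subg // (affine_index_isog isoHK).
have sD H : H \in s -> H \in D by move/sP/DP.
have Ucl : uniq (map cl s).
  rewrite map_inj_in_uniq // => H K sH sK /setP/(_ K).
  rewrite !inE isog_refl andbT => eK; apply: s_inj => //; move: eK.
  by have /setIdP[_ ->] := sD K sK; case/andP.
rewrite (bigID (mem (map cl s))) /= [X in (_ + X)%N]big1 ?addn0; last first.
  move=> _ /andP[/imsetP[H DH ->] s'H]; rewrite -/(cl H) clE //.
  have [oH PH] := DP H DH.
  case: (posnP #|affine_cycles H|) => [X0|/(s_cov H oH PH)[K sK isoHK]].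
    by rewrite /affine_index X0 div0n.
  case/negP: s'H; apply/mapP; exists K => //.
  apply/setP=> L; rewrite !inE; congr (_ && _).
  by apply/idP/idP; apply: isog_trans; rewrite // isog_sym.
rewrite (eq_bigl (mem (map cl s))); last first.
  move=> C /=; apply/andb_idl => /mapP[H sH ->].
  by apply/imsetP; exists H => //; apply: sD.
rewrite -big_uniq //= big_map; apply: eq_big_seq => H sH.
by rewrite clE ?sD.
Qed.

(** * Radicals, and separation of the isomorphism types *)

Lemma radical_pow2M v n : 0 < v -> odd n -> radical (2 ^ v * n) = (2 * radical n)%N.
Proof.
move=> v_gt0 n_odd; have n_gt0 := odd_gt0 n_odd.
rewrite /radical -[in RHS](big_cons _ _ _ _ xpredT (fun p => p)).
apply: perm_big; apply: uniq_perm; first exact: primes_uniq.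
  by rewrite /= primes_uniq andbT mem_primes /= dvdn2 n_odd andbF.
by move=> p; rewrite primesM ?expn_gt0 // primesX // primes_prime // !inE.
Qed.

Lemma radical_gt0 n : 0 < radical n.
Proof.
rewrite /radical big_seq; apply: prodn_cond_gt0 => p.
by rewrite mem_primes => /andP[/prime_gt0].
Qed.

Lemma radical_dvdn n : odd n -> radical n %| n.
Proof. by move=> n_odd; rewrite -hd_modulus_odd // hd_modulus_dvdn. Qed.

(** The divisor is [4 * radical n], whence the exponent [v.-2], the same as in the dihedral and
    quaternion counts. *)
Lemma divn_radical_pow2M v n : 1 < v -> odd n ->
  (2 ^ v * n) %/ (2 * radical (2 ^ v * n)) = (2 ^ v.-2 * (n %/ radical n))%N.
Proof.
case: v => [|[|v]] // _ n_odd; rewrite radical_pow2M //=.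
have /dvdnP[k {1 3}->] := radical_dvdn n_odd.
rewrite mulnK ?radical_gt0 //.
have -> : (2 ^ v.+2 * (k * radical n) = (2 ^ v * k) * (2 * (2 * radical n)))%N.
  by rewrite !expnS; ring.
by rewrite mulnK // !muln_gt0 radical_gt0.
Qed.

Lemma abelian_setX_inv (gT kT : finGroupType) (A : {group gT}) (B : {group kT}) :
  abelian (setX A B) -> abelian A.
Proof.
have /dprodP[_ defX _ _] := setX_dprod A B; rewrite -defX => cAB.
have := abelianS (mulG_subl _ _) cAB.
by rewrite -(isog_abelian (isog_setX1 kT A)).
Qed.

Lemma dihedral_nonabelian v : v > 2 -> ~~ abelian 'D_(2 ^ v).
Proof.
move=> v_gt2; have v_gt1 := ltnW v_gt2.
have iso := isog_refl ('D_(2 ^ v))%G.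
have [[m g] gen _] := generators_2dihedral v_gt1 iso.
have [_ [_ _ _ cl] _ _ _] := dihedral2_structure v_gt1 gen iso.
by rewrite -nil_class1 cl -ltnNge; case: v v_gt2 {v_gt1 iso m g gen cl} => [|[|[|]]].
Qed.

Lemma quaternion_nonabelian v : v > 2 -> ~~ abelian 'Q_(2 ^ v).
Proof.
move=> v_gt2.
have iso := isog_refl ('Q_(2 ^ v))%G.
have [[m g] gen _] := generators_quaternion v_gt2 iso.
have [_ [_ _ _ cl] _ _ _] := quaternion_structure v_gt2 gen iso.
by rewrite -nil_class1 cl -ltnNge; case: v v_gt2 {iso m g gen cl} => [|[|[|]]].
Qed.

(** The 2-group factor is recovered as ['O_2], which isomorphisms preserve. *)
Lemma isog_setX_Zp_2group (gT kT : finGroupType) (A : {group gT}) (B : {group kT}) n :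
    odd n -> 2.-group A -> 2.-group B ->
  setX A (Zp n) \isog setX B (Zp n) -> A \isog B.
Proof.
move=> n_odd.
have O2 (hT : finGroupType) (C : {group hT}) : 2.-group C ->
    'O_2(setX C (Zp n)) = setX C 1.
  move=> pC; have defX := setX_dprod C (Zp n)%G; have iso1 := isog_setX1 'Z_n C.
  have pC1 : 2.-group (setX C [1 'Z_n]).
    by have := isog_pgroup 2 iso1; rewrite pC => /esym.
  apply: (normal_Hall_pcore (H := (setX C 1)%G) (G := (setX C (Zp n))%G)); last first.
    by have [] := dprod_normal2 defX.
  rewrite /pHall pC1 /= -{1}(setX_prod C (Zp n)) mulG_subl.
  have oX : #|setX C (Zp n)| = (#|setX C [1 'Z_n]| * n)%N.
    by rewrite !cardsX cards1 muln1 card_Zp ?odd_gt0.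
  rewrite -divgS ?oX ?mulKn ?cardG_gt0 //=.
    by rewrite p'natE // dvdn2 n_odd.
  by rewrite -{1}(setX_prod C (Zp n)) mulG_subl.
move=> pA pB iso; have := isog_pcore 2 iso; rewrite !O2 // => iso2.
apply: isog_trans (isog_setX1 'Z_n A) _; apply: isog_trans iso2 _.
by rewrite isog_sym; apply: isog_setX1.
Qed.

Lemma dihedral_not_quaternion v : v > 2 -> ~~ ('D_(2 ^ v) \isog 'Q_(2 ^ v)).
Proof.
move=> v_gt2; apply/negP=> iso.
have /quaternion_classP : exists2 n, n > 2 & ('D_(2 ^ v))%G \isog 'Q_(2 ^ n).
  by exists v.
have /dihedral_classP -> // : exists2 n, n > 1 & ('D_(2 ^ v))%G \isog 'D_(2 ^ n).
by exists v; rewrite ?isog_refl // ltnW.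
Qed.

Lemma Cayley_group_isog (kT : finGroupType) (K : {group kT}) n : #|K| = n ->
  exists2 H : {group {perm 'I_n}}, K \isog H & #|H| = n.
Proof.
move=> oK; have oS : #|subg_of K| = n.
  by rewrite card_sub -oK; apply: eq_card.
have [H iso] := Cayley_ordinal oS.
have isoK := isog_trans (isog_subg K) iso.
by exists H; rewrite // -(card_isog isoK).
Qed.

Lemma pow2_odd_inj v w a b : odd a -> odd b -> (2 ^ v * a = 2 ^ w * b)%N ->
  v = w /\ a = b.
Proof.
move=> oa ob e.
have log u c : odd c -> logn 2 (2 ^ u * c) = u.
  move=> oc; rewrite lognM ?expn_gt0 ?(odd_gt0 oc) // pfactorK //.
  by rewrite logn_coprime ?addn0 // coprime2n.
have evw : v = w by rewrite -(log v a oa) e log.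
by split=> //; apply/eqP; rewrite -(eqn_pmul2l (_ : 0 < 2 ^ v)) ?expn_gt0 // e evw.
Qed.

Lemma card_setX_Zp (hT : finGroupType) (P : {group hT}) n : odd n ->
  #|setX P (Zp n)| = (#|P| * n)%N.
Proof. by move=> n_odd; rewrite cardsX card_Zp ?odd_gt0. Qed.

Lemma nilpotent_setX_Zp (hT : finGroupType) (P : {group hT}) n :
  2.-group P -> nilpotent (setX P (Zp n)).
Proof.
move=> pP; rewrite (dprod_nil (setX_dprod P (Zp n)%G)).
have := isog_nil (isog_setX1 'Z_n P); rewrite (pgroup_nil pP) => <-.
have := isog_nil (isog_set1X hT (Zp n)%G).
by rewrite (abelian_nil (cyclic_abelian (cyclic_Zp n))) => <-.
Qed.

Lemma dihedral_pgroup v : v > 1 -> 2.-group 'D_(2 ^ v).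
Proof. by move=> v_gt1; rewrite /pgroup card_2dihedral // pnatX. Qed.

Lemma quaternion_pgroup v : v > 2 -> 2.-group 'Q_(2 ^ v).
Proof. by move=> v_gt2; rewrite /pgroup card_quaternion // pnatX. Qed.

Lemma affine_index_dihedral_setX v n : v > 1 -> odd n ->
  affine_index (setX 'D_(2 ^ v) (Zp n))%G = (2 ^ v.-2 * (n %/ radical n))%N.
Proof.
move=> v_gt1 n_odd; apply: affine_index_setX => //; first exact: dihedral_pgroup.
by apply: card_affine_cycles_dihedral => //; apply: isog_refl.
Qed.

Lemma affine_index_quaternion_setX v n : v > 2 -> odd n ->
  affine_index (setX 'Q_(2 ^ v) (Zp n))%G = (2 ^ v.-2 * (n %/ radical n))%N.
Proof.
move=> v_gt2 n_odd; apply: affine_index_setX => //; first exact: quaternion_pgroup.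
by apply: card_affine_cycles_quaternion => //; apply: isog_refl.
Qed.

(** ['D_(2 ^ 2)] is the Klein four-group, obtained by moving the 2-part of [Zp (2 * n)] to the first
    factor. This brings orders that are 4 modulo 8 under the dihedral count. *)
Lemma isog_C2_C2n n : odd n ->
  setX (Zp 2) (Zp (2 * n)) \isog setX 'D_(2 ^ 2) (Zp n).
Proof.
move=> n_odd; have n_gt0 := odd_gt0 n_odd.
pose K := setX_group [1 ('Z_2)]%G (Zp (2 * n))%G.
have isoK : Zp (2 * n) \isog K by apply: isog_set1X.
have oK : #|K| = (2 * n)%N by rewrite -(card_isog isoK) card_Zp // muln_gt0.
have cK : cyclic K by rewrite -(isog_cyclic isoK) cyclic_Zp.
have defK := nilpotent_pcoreC 2 (abelian_nil (cyclic_abelian cK)).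
have o2 : #|'O_2(K)| = 2.
  rewrite (card_Hall (nilpotent_pcore_Hall 2 (abelian_nil (cyclic_abelian cK)))) oK.
  by rewrite partnM // part_pnat_id // part_p'nat ?muln1 // p'natE // dvdn2 n_odd.
have o2' : #|'O_2^'(K)| = n.
  by apply/eqP; rewrite -(eqn_pmul2l (isT : 0 < 2)) -{1}o2 (dprod_card defK) oK.
have defX := setX_dprod (Zp 2)%G (Zp (2 * n))%G.
rewrite -[setX 1 _]/(K : {set _}) -defK dprodA in defX.
have [[L M defL _] _ _ _] := dprodP defX.
rewrite defL in defX.
have abL : 2.-abelem L.
  rewrite (dprod_abelem _ defL); apply/andP; split.
    apply: prime_abelem => //; rewrite -(card_isog (isog_setX1 _ (Zp 2)%G)).
    by rewrite card_Zp.
  by apply: prime_abelem.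
have oL : #|L| = 4.
  rewrite -(dprod_card defL) o2 -(card_isog (isog_setX1 _ (Zp 2)%G)).
  by rewrite card_Zp.
apply: (dprod_isog_setX (G := (setX (Zp 2) (Zp (2 * n)))%G) defX).
  have iso := isog_refl ('D_(2 ^ 2))%G.
  have [[m g] gen _] := generators_2dihedral (isT : 1 < 2) iso.
  have [_ _ _ _ abD] := dihedral2_structure (isT : 1 < 2) gen iso.
  by rewrite (isog_abelem_card _ abL) abD oL card_2dihedral.
rewrite isog_cyclic_card ?cyclic_Zp /= ?card_Zp // ?o2' //.
exact: cyclicS (pcore_sub _ _) cK.
Qed.

(** * Sums with one, two or three contributing classes *)

Section Main.

Variable gT : finGroupType.
Hypothesis cG : cyclic [set: gT].
Let n := #|gT|.

Lemma affine_index_cyclic_order (hT : finGroupType) (H : {group hT}) :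
  cyclic H -> #|H| = n -> affine_index H = n %/ hd_modulus n.
Proof. by move=> cH oH; rewrite affine_index_cyclic ?oH. Qed.

Lemma e_HG_cyclic_self : e_HG gT gT = n %/ hd_modulus n.
Proof. by rewrite e_HG_affine_index // affine_index_cyclic_order ?cardsT. Qed.

Let cyc_rep : exists H : {group {perm 'I_n}}, [/\ cyclic H, #|H| = n
  & forall K : {group {perm 'I_n}}, cyclic K -> #|K| = n -> K \isog H].
Proof.
have oT : #|[set: gT]%G| = n by rewrite cardsT.
have [H iso oH] := Cayley_group_isog oT.
have cH : cyclic H by rewrite -(isog_cyclic iso).
by exists H; split=> // K cK oK; rewrite isog_cyclic_card // cH oK oH /=.
Qed.

Lemma e_sum_only_cyclic (P : forall k, {group {perm 'I_k}} -> bool) :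
    (forall H : {group {perm 'I_n}}, cyclic H -> P n H) ->
    (forall H : {group {perm 'I_n}}, #|H| = n -> P n H ->
       0 < #|affine_cycles H| -> cyclic H) ->
  e_sum gT P = n %/ hd_modulus n.
Proof.
move=> Pc Xc; have [H [cH oH isoH]] := cyc_rep.
rewrite (@e_sum_reps _ _ [:: H]) // ?big_seq1 ?affine_index_cyclic_order //.
- by move=> K; rewrite inE => /eqP->; rewrite oH Pc.
- by move=> K L; rewrite !inE => /eqP-> /eqP->.
move=> K oK PK XK; exists H; rewrite ?inE //.
by apply: isoH => //; apply: Xc.
Qed.

Lemma e_sum_two (P : forall k, {group {perm 'I_k}} -> bool)
    (kT : finGroupType) (L : {group kT}) :
    #|L| = n -> ~~ cyclic L ->
    (forall H : {group {perm 'I_n}}, cyclic H || (H \isog L) -> P n H) ->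
    (forall H : {group {perm 'I_n}}, #|H| = n -> P n H ->
       0 < #|affine_cycles H| -> cyclic H || (H \isog L)) ->
  e_sum gT P = (n %/ hd_modulus n + affine_index L)%N.
Proof.
move=> oL ncL Pc Xc; have [H [cH oH isoH]] := cyc_rep.
have [K isoK oK] := Cayley_group_isog oL; have isoK' := isog_symr isoK.
have ncK : ~~ cyclic K by rewrite -(isog_cyclic isoK).
have HK : ~~ (H \isog K).
  by apply: contra ncK => iso; rewrite -(isog_cyclic iso).
rewrite (@e_sum_reps _ _ [:: H; K]) //.
- by rewrite big_cons big_seq1 affine_index_cyclic_order // (affine_index_isog isoK).
- by rewrite /= inE andbT; apply: contra HK => /eqP->; apply: isog_refl.
- by move=> M; rewrite !inE => /orP[]/eqP->; rewrite ?oH ?oK Pc ?cH ?isoK' ?orbT.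
- move=> M N; rewrite !inE => /orP[]/eqP-> /orP[]/eqP-> //; first by rewrite (negPf HK).
  by rewrite isog_sym (negPf HK).
move=> M oM PM XM; have /orP[cM|isoM] := Xc M oM PM XM.
  by exists H; rewrite ?inE ?eqxx //; apply: isoH.
by exists K; rewrite ?inE ?eqxx ?orbT //; apply: isog_trans isoM isoK.
Qed.

Lemma e_sum_three (P : forall k, {group {perm 'I_k}} -> bool)
    (kT lT : finGroupType) (K : {group kT}) (L : {group lT}) :
    #|K| = n -> #|L| = n -> ~~ cyclic K -> ~~ cyclic L -> ~~ (K \isog L) ->
    (forall H : {group {perm 'I_n}}, [|| cyclic H, H \isog K | H \isog L] -> P n H) ->
    (forall H : {group {perm 'I_n}}, #|H| = n -> P n H ->
       0 < #|affine_cycles H| -> [|| cyclic H, H \isog K | H \isog L]) ->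
  e_sum gT P = (n %/ hd_modulus n + affine_index K + affine_index L)%N.
Proof.
move=> oK oL ncK ncL KL Pc Xc; have [H [cH oH isoH]] := cyc_rep.
have [K1 isoK oK1] := Cayley_group_isog oK; have isoK' := isog_symr isoK.
have [L1 isoL oL1] := Cayley_group_isog oL; have isoL' := isog_symr isoL.
have HK : ~~ (H \isog K1).
  by apply: contra ncK => iso; rewrite (isog_cyclic isoK) -(isog_cyclic iso).
have HL : ~~ (H \isog L1).
  by apply: contra ncL => iso; rewrite (isog_cyclic isoL) -(isog_cyclic iso).
have {}KL : ~~ (K1 \isog L1).
  by apply: contra KL => iso; apply: isog_trans isoK (isog_trans iso isoL').
have neq (M N : {group {perm 'I_n}}) : ~~ (M \isog N) -> M != N.
  by apply: contraNneq => ->; apply: isog_refl.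
rewrite (@e_sum_reps _ _ [:: H; K1; L1]) //.
- rewrite !big_cons big_nil addn0 affine_index_cyclic_order // addnA.
  by rewrite (affine_index_isog isoK) (affine_index_isog isoL).
- by rewrite /= !inE negb_or !neq.
- move=> M; rewrite !inE => /or3P[]/eqP->;
    by rewrite ?oH ?oK1 ?oL1 Pc ?cH ?isoK' ?isoL' ?orbT.
- have sy (M N : {group {perm 'I_n}}) : ~~ (M \isog N) -> N \isog M -> N = M.
    by move=> /negPf MN; rewrite isog_sym MN.
  move=> M N; rewrite !inE => /or3P[]/eqP-> /or3P[]/eqP-> //.
  + by rewrite (negPf HK).
  + by rewrite (negPf HL).
  + exact: sy.
  + by rewrite (negPf KL).
  + exact: sy.
  exact: sy.
move=> M oM PM XM; have /or3P[cM|isoM|isoM] := Xc M oM PM XM.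
- by exists H; rewrite ?inE ?eqxx //; apply: isoH.
- by exists K1; rewrite ?inE ?eqxx ?orbT //; apply: isog_trans isoM isoK.
by exists L1; rewrite ?inE ?eqxx ?orbT //; apply: isog_trans isoM isoL.
Qed.

End Main.

Lemma affine_cycle_not_4dvd_cyclic (hT : finGroupType) (H : {group hT}) :
  nilpotent H -> 0 < #|affine_cycles H| -> ~~ (4 %| #|H|) -> cyclic H.
Proof.
move=> nilH XH n4; have [//|[v [m [_ oH D]]]] := affine_cycle_nil_structure nilH XH.
case/negP: n4; have v_gt1 : 1 < v by case: D => [[]|[/ltnW]].
by rewrite oH dvdn_mulr // -[4]/(2 ^ 2)%N dvdn_exp2l.
Qed.

Lemma affine_cycle_order_structure (hT : finGroupType) (H : {group hT}) v n :
    nilpotent H -> 0 < #|affine_cycles H| -> #|H| = (2 ^ v * n)%N -> odd n ->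
  [|| cyclic H, H \isog setX 'D_(2 ^ v) (Zp n)
    | (2 < v) && (H \isog setX 'Q_(2 ^ v) (Zp n))].
Proof.
move=> nilH XH oH n_odd.
have [->//|[w [m [m_odd oH' D]]]] := affine_cycle_nil_structure nilH XH.
rewrite oH in oH'; have [-> ->] := pow2_odd_inj n_odd m_odd oH'.
by case: D => -[w_gt ->]; rewrite ?w_gt ?orbT.
Qed.

(** A dihedral 2-group is generated by its involutions, whereas a nontrivial cyclic one has a single
    involution, generating a group of order 2. *)
Lemma dihedral_not_cyclic v : v > 1 -> ~~ cyclic 'D_(2 ^ v).
Proof.
move=> v_gt1; apply/negP=> cD; have iso := isog_refl ('D_(2 ^ v))%G.
have [[m g] gen _] := generators_2dihedral v_gt1 iso.
have [_ _ [Ohm_D _] _ _] := dihedral2_structure v_gt1 gen iso.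
have oD := card_2dihedral v_gt1.
have ntD : 'D_(2 ^ v) != 1 by rewrite -cardG_gt1 oD (ltn_exp2l 0) // ltnW.
have := Ohm1_cyclic_pgroup_prime cD (dihedral_pgroup v_gt1) ntD.
rewrite Ohm_D oD => /eqP; rewrite -[X in _ == X]expn1 eqn_exp2l //.
by case: v v_gt1 {cD iso m g gen Ohm_D oD ntD} => [|[]].
Qed.

Lemma cyclic_setX_inv (gT kT : finGroupType) (A : {group gT}) (B : {group kT}) :
  cyclic (setX A B) -> cyclic A.
Proof.
have sAX : setX_group A 1%G \subset setX_group A B.
  by rewrite /= -(setX_prod A B) mulG_subl.
by move/(cyclicS sAX); rewrite -(isog_cyclic (isog_setX1 kT A)).
Qed.

Lemma divn_halves d R : 0 < R -> (2 * R %| d)%N ->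
  (d %/ (2 * R) + d %/ (2 * R) = d %/ R)%N.
Proof.
move=> R_gt0 /dvdnP[k ->]; rewrite mulnK ?muln_gt0 // [(k * _)%N]mulnA mulnK //.
by rewrite addnn muln2.
Qed.

Local Close Scope group_scope.

Theorem theorem2 (gT : finGroupType) :
  cyclic [set: gT] ->
  let n := #|gT| in
  [/\ (~~ (4 %| n) ->
         e_nil gT = n %/ radical n /\ e_ab gT = n %/ radical n /\
         e_HG gT gT = n %/ radical n),
      (n %% 8 = 4 ->
         [/\ e_nil gT = n %/ radical n, e_ab gT = n %/ radical n,
             e_HG gT gT = n %/ (2 * radical n) &
             e_HG gT (subg_of (setX (Zp 2) (Zp (n %/ 2)))%G) = n %/ (2 * radical n)]) &
      (forall v n' : nat, 3 <= v -> odd n' -> n = 2 ^ v * n' ->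
         [/\ e_nil gT = (3 * n) %/ (2 * radical n),
             e_ab gT = n %/ (2 * radical n),
             e_HG gT gT = n %/ (2 * radical n),
             e_HG gT (subg_of (setX 'D_(2 ^ v) (Zp n'))%G) = n %/ (2 * radical n) &
             e_HG gT (subg_of (setX 'Q_(2 ^ v) (Zp n'))%G) = n %/ (2 * radical n)])].
Proof.
move=> cG n; have n_gt0 : 0 < n by apply/card_gt0P; exists 1%g.
have e_self := e_HG_cyclic_self cG; rewrite -/n hd_modulusE // in e_self.
have cyc_nil (hT : finGroupType) (H : {group hT}) : cyclic H -> nilpotent H.
  by move/cyclic_abelian/abelian_nil.
split=> [n4 | n4 | v m v_gt2 m_odd def_n].
- rewrite (negPf n4) in e_self; rewrite e_self /e_nil /e_ab.
  rewrite !e_sum_only_cyclic -/n ?hd_modulusE ?(negPf n4) //.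
  + by move=> H /cyclic_abelian.
  + move=> H oH cH XH; apply: affine_cycle_not_4dvd_cyclic => //; last by rewrite oH.
    exact: abelian_nil.
  + by move=> H; apply: cyc_nil.
  by move=> H oH cH XH; apply: affine_cycle_not_4dvd_cyclic => //; rewrite oH.
- have [m m_odd def_n] : exists2 m, odd m & n = 2 ^ 2 * m.
    (* [n = 8q + 4 = 4 (2q + 1)]. *)
    exists (n %/ 8).*2.+1; first by rewrite /= odd_double.
    by rewrite {1}(divn_eq n 8) n4 -addn1 -mul2n; ring.
  have dv4 : 4 %| n by rewrite def_n dvdn_mulr.
  rewrite dv4 in e_self; rewrite e_self.
  have isoL := isog_C2_C2n m_odd.
  have def_n2 : n %/ 2 = 2 * m by rewrite def_n -[2 ^ 2]/(2 * 2) -mulnA mulKn.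
  pose L := setX_group (Zp_group 2) (Zp_group (2 * m)).
  have isoL' : L \isog setX_group ('D_(2 ^ 2))%G (Zp_group m) by [].
  have abL : abelian L.
    by apply/centsP=> -[x1 x2] _ [y1 y2] _; congr (_, _); apply: Zp_mulgC.
  have ncL : ~~ cyclic L.
    rewrite (isog_cyclic isoL').
    by apply: contra (dihedral_not_cyclic (isT : 1 < 2)); apply: cyclic_setX_inv.
  have oL : #|L| = n.
    by rewrite def_n cardsX !card_Zp ?muln_gt0 ?(odd_gt0 m_odd) // mulnA.
  have iL : affine_index L = n %/ (2 * radical n).
    rewrite (affine_index_isog isoL') affine_index_dihedral_setX //.
    by rewrite def_n divn_radical_pow2M.
  (* The cyclic group and [L] each contribute half of [n %/ radical n]. *)
  have tot : n %/ hd_modulus n + affine_index L = n %/ radical n.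
    have := hd_modulus_dvdn n; rewrite iL hd_modulusE // dv4 => dvR.
    by apply: divn_halves dvR; apply: radical_gt0.
  have cov (H : {group {perm 'I_n}}) : #|H| = n -> nilpotent H ->
      0 < #|affine_cycles H| -> cyclic H || (H \isog L).
    move=> oH nilH XH; have {}oH := etrans oH def_n.
    have /or3P[->//|isoH|//] := affine_cycle_order_structure nilH XH oH m_odd.
    by rewrite (isog_trans isoH (isog_symr isoL')) orbT.
  split=> //; last by rewrite def_n2 e_HG_subg // oL.
    rewrite -tot; apply: e_sum_two => //.
    move=> H /orP[/cyc_nil//|isoH].
    by rewrite (isog_nil isoH) abelian_nil.
  rewrite -tot; apply: e_sum_two => // [H /orP[/cyclic_abelian//|isoH]|H oH abH].
    by rewrite (isog_abelian isoH).
  by apply: cov => //; apply: abelian_nil.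
have dv4 : 4 %| n by rewrite def_n dvdn_mulr // -[4]/(2 ^ 2) dvdn_exp2l // ltnW.
rewrite dv4 in e_self; rewrite e_self.
have v_gt1 := ltnW v_gt2.
pose K := setX_group ('D_(2 ^ v))%G (Zp_group m).
pose L := setX_group ('Q_(2 ^ v))%G (Zp_group m).
have oK : #|K| = n by rewrite card_setX_Zp // card_2dihedral.
have oL : #|L| = n by rewrite card_setX_Zp // card_quaternion.
have nabK : ~~ abelian K.
  by apply: contra (dihedral_nonabelian v_gt2); apply: abelian_setX_inv.
have nabL : ~~ abelian L.
  by apply: contra (quaternion_nonabelian v_gt2); apply: abelian_setX_inv.
have iK : affine_index K = n %/ (2 * radical n).
  by rewrite affine_index_dihedral_setX // def_n divn_radical_pow2M.
have iL : affine_index L = n %/ (2 * radical n).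
  by rewrite affine_index_quaternion_setX // def_n divn_radical_pow2M.
have KL : ~~ (K \isog L).
  apply: contra (dihedral_not_quaternion v_gt2).
  apply: (isog_setX_Zp_2group m_odd); first exact: dihedral_pgroup.
  exact: quaternion_pgroup.
have cov (H : {group {perm 'I_n}}) : #|H| = n -> nilpotent H ->
    0 < #|affine_cycles H| -> [|| cyclic H, H \isog K | H \isog L].
  move=> oH nilH XH; have {}oH := etrans oH def_n.
  by have := affine_cycle_order_structure nilH XH oH m_odd; rewrite v_gt2.
have hdn : n %/ hd_modulus n = n %/ (2 * radical n) by rewrite hd_modulusE // dv4.
split=> //; last first.
- by rewrite e_HG_subg // oL.
- by rewrite e_HG_subg // oK.
- rewrite -hdn; apply: e_sum_only_cyclic => // [H /cyclic_abelian//|H oH abH XH].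
  have /or3P[//|iso|iso] := cov H oH (abelian_nil abH) XH.
    by rewrite -(isog_abelian iso) abH in nabK.
  by rewrite -(isog_abelian iso) abH in nabL.
(* Three equal contributions; the factor 3 leaves the quotient because [hd_modulus n] divides
   [n]. *)
have -> : (3 * n) %/ (2 * radical n) =
    n %/ hd_modulus n + affine_index K + affine_index L.
  rewrite iK iL -hdn -[2 * radical n](_ : hd_modulus n = _); last first.
    by rewrite hd_modulusE // dv4.
  by rewrite -muln_divA ?hd_modulus_dvdn // mulSn mul2n -addnn addnA.
apply: e_sum_three => //.
- by apply: contra nabK; apply: cyclic_abelian.
- by apply: contra nabL; apply: cyclic_abelian.
move=> H /or3P[/cyc_nil//|iso|iso]; rewrite (isog_nil iso).
  by apply: nilpotent_setX_Zp; apply: dihedral_pgroup.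
by apply: nilpotent_setX_Zp; apply: quaternion_pgroup.
Qed.
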